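(* Let $t$ be a rational integer congruent to $2$ modulo $7$, or to $-21$, $-18$, $-16$, $-8$ or $11$ modulo $49$, or to $743$ modulo $2401$. If the polynomial $$Y^3-tY^2-(2t^2-7t+21)Y+t^3+28$$ is irreducible over $\mathbb{Q}$, then for $y$ a root of it, $\mathbb{Q}(y)$ is a cyclic extension of $\mathbb{Q}$; and if $$p(x)=x^7+21x^5-7(t^2-4t+10)x^4+28(t^2-3t+15)x^3-7(5t^3-8t^2+12t+72)x^2+7(5t+6)(2t^2-7t+22)x-t^5-20t^4-94t^3+410t^2-1584t+1224$$ is likewise irreducible over $\mathbb{Q}$, then the splitting field of $p(x)$ over $K=\mathbb{Q}(\sqrt{-7(t-2)^2-28},\,y)$ is an unramified cyclic extension of $K$.
   Context: A cyclic extension is a Galois extension with cyclic Galois group. *)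

(* Defs.v *)
From HB Require Import structures.
From mathcomp Require Import all_boot all_order all_algebra all_fingroup
  all_solvable all_field.

Set Implicit Arguments.
Unset Strict Implicit.
Unset Printing Implicit Defensive.

Import Order.TTheory GRing.Theory Num.Theory.
Local Open Scope ring_scope.

Section NumberFields.

(* All number fields are subfields of an ambient finite normal extension L of
   rat; subsets of L are arbitrary predicates L -> Prop. *)
Variable L : splittingFieldType rat.

Definition cyclic_extension (K E : {subfield L}) : Prop :=
  galois K E /\ cyclic 'Gal(E / K).

Definition ring_of_integers (E : {subfield L}) : L -> Prop :=
  fun x => x \in E /\ integralOver (intr : int -> L) x.

Definition is_ideal (O I : L -> Prop) : Prop :=
  [/\ forall x, I x -> O x,
      I 0,
      forall x y, I x -> I y -> I (x + y)
    & forall a x, O a -> I x -> I (a * x)].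

Definition nonzero_prime_ideal (O P : L -> Prop) : Prop :=
  [/\ is_ideal O P,
      ~ P 1,
      forall x y, O x -> O y -> P (x * y) -> P x \/ P y
    & exists2 x, P x & x != 0].

Definition ideal_mul (I J : L -> Prop) : L -> Prop :=
  fun x => exists n (a b : 'I_n -> L),
    [/\ forall i, I (a i), forall i, J (b i) & x = \sum_(i < n) a i * b i].

Definition ideal_exp (O P : L -> Prop) (n : nat) : L -> Prop :=
  iter n (ideal_mul P) O.

(* e(P | p) = e for p = P :&: K: the extended ideal p O_E lies in P ^ e but
   not in P ^ (e + 1). *)
Definition ramification_index (K E : {subfield L}) (P : L -> Prop) (e : nat)
    : Prop :=
  let OE := ring_of_integers E in
  let pOE := ideal_mul (fun x => P x /\ x \in K) OE in
  (forall x, pOE x -> ideal_exp OE P e x) /\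
  ~ (forall x, pOE x -> ideal_exp OE P e.+1 x).

(* Residue fields are finite, so residue extensions are always separable and
   only the ramification index matters. *)
Definition unramified_finite (K E : {subfield L}) : Prop :=
  forall P : L -> Prop, nonzero_prime_ideal (ring_of_integers E) P ->
    ramification_index K E P 1.

(* No real place of K lies below a complex place of E. *)
Definition unramified_infinite (K E : {subfield L}) : Prop :=
  forall f : {rmorphism subvs_of E -> algC},
    (forall x : subvs_of E, vsval x \in K -> f x \is Num.real) ->
    forall x : subvs_of E, f x \is Num.real.

Definition unramified_extension (K E : {subfield L}) : Prop :=
  [/\ (K <= E)%VS, unramified_finite K E & unramified_infinite K E].

End NumberFields.

Definition cubic (t : int) : {poly int} :=
  'X^3 - t *: 'X^2 - (2 * t ^+ 2 - 7 * t + 21) *: 'X + (t ^+ 3 + 28)%:P.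

Definition septic (t : int) : {poly int} :=
  'X^7 + 21 *: 'X^5
  - (7 * (t ^+ 2 - 4 * t + 10)) *: 'X^4
  + (28 * (t ^+ 2 - 3 * t + 15)) *: 'X^3
  - (7 * (5 * t ^+ 3 - 8 * t ^+ 2 + 12 * t + 72)) *: 'X^2
  + (7 * (5 * t + 6) * (2 * t ^+ 2 - 7 * t + 22)) *: 'X
  + (- t ^+ 5 - 20 * t ^+ 4 - 94 * t ^+ 3 + 410 * t ^+ 2 - 1584 * t + 1224)%:P.

Definition congruence_condition (t : int) : Prop :=
  (t = 2 %[mod 7])%Z \/
  (t = -21 %[mod 49])%Z \/ (t = -18 %[mod 49])%Z \/ (t = -16 %[mod 49])%Z \/
  (t = -8 %[mod 49])%Z \/ (t = 11 %[mod 49])%Z \/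
  (t = 743 %[mod 2401])%Z.

(* Main.v *)
(** Over [K] the septic has a cyclic group: with [theta_i = r_i + 1], where
    [r_0, .., r_6] are its roots in cyclic order, multiplication by [r_0] has an
    explicit matrix in the [theta_i] with entries in [K], and its cyclic shifts
    commute with it and are annihilated by the septic.  As the septic stays
    irreducible over [K] (the degrees 7 and 6 are coprime), the other roots are
    thereby polynomials in one of them.

    A prime [P] of the top field that ramifies in this extension of degree 7 has
    full inertia group, so the characteristic polynomial of any integral
    [(x - c) w], with [x] a root of the septic and [w] in [K], is a seventh power
    modulo [P].  With [w = 1] this forces [7] into [P], because three coefficients
    of the septic that would otherwise lie in [P] are coprime away from 7.  For
    each of the residue classes of [t] there are [c] and [w] (an element of [K] of negative
    7-adic valuation) for which some middle coefficient is a 7-adic unit, whereas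
    the middle coefficients of a seventh power are divisible by 7.  No real place
    of [K] exists, since [s^2 < 0]. *)
From Stdlib Require Import ZArith Classical.
Require Import Defs.
From HB Require Import structures.
From mathcomp Require Import all_boot all_order all_algebra all_fingroup
  all_solvable all_field.
From mathcomp Require Import ssrZ zify ring.
Set Implicit Arguments.
Unset Strict Implicit.
Unset Printing Implicit Defensive.
Import Order.TTheory GRing.Theory Num.Theory.
Local Open Scope ring_scope.

(** * The septic field by structure constants *)

Delimit Scope Z_scope with coqZ.

(** The roots of the septic sum to 0 and so are linearly dependent; adding 1 to each makes the sum
    7, and the row (1, .., 1), the coordinates of 7, then serves as a cyclic vector. Nothing has to
    be known about the table beyond three facts checked by computation: commutation, annihilation of
    that row, and the column sums. They are identities with coefficients in Z[t, y, z, s], so one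
    computation settles all t at once.

    Ramification is phrased with products of ideals only. In place of unique factorisation there is
    a trace argument: if every nontrivial automorphism moves some integer modulo P, then P lies in p
    O + P^2, with p below P; so p O inside P^2 would give P = P^2, against a determinant argument.

    Modulo 7 the septic is a seventh power, and the multiplier w has to cancel a fractional power of
    7 dividing x - c. The field K supplies such fractions: in the classes at hand s has 7-adic
    valuation 1/2 and, where it is used, y - b has valuation 1/3, whence w of valuation -1/2, -1/6
    or -1/3. *)

Definition tpoly : Type := seq Z.

Fixpoint tadd (p q : tpoly) : tpoly :=
  match p, q with
  | [::], _ => q
  | _, [::] => p
  | a :: p', b :: q' => Z.add a b :: tadd p' q'
  end.

Definition tscale (a : Z) (p : tpoly) : tpoly := map (Z.mul a) p.

Fixpoint tmul (p q : tpoly) : tpoly :=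
  if p is a :: p' then tadd (tscale a q) (Z0 :: tmul p' q) else [::].

Definition tzero (p : tpoly) : bool := all (Z.eqb Z0) p.

(* A [tpoly] is a polynomial in [t], constant term first; [(a, b, c)] stands for
   [a + b y + c z] and [(u, v)] for [u + v s], where [y], [z] are two roots of
   the cubic and [s^2 = -7 (t - 2)^2 - 28]. *)
Definition celt : Type := tpoly * tpoly * tpoly.
Definition kelt : Type := celt * celt.

Definition cadd (u v : celt) : celt :=
  let: (a, b, c) := u in let: (a', b', c') := v in
  (tadd a a', tadd b b', tadd c c').

Definition cscale (p : tpoly) (u : celt) : celt :=
  let: (a, b, c) := u in (tmul p a, tmul p b, tmul p c).

Definition cmul (u v : celt) : celt :=
  let: (a, b, c) := u in let: (a', b', c') := v in
  let yy := tmul b b' in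
  let yz := tadd (tmul b c') (tmul c b') in
  let zz := tmul c c' in
  cadd (tmul a a', tadd (tmul a b') (tmul b a'), tadd (tmul a c') (tmul c a'))
    (cadd (cscale yy ([:: 14; -5; 2]%coqZ, [:: -1]%coqZ, [:: 2; -1]%coqZ))
      (cadd (cscale yz ([:: -7; 1; -1]%coqZ, [:: 3]%coqZ, [:: 1; 1]%coqZ))
         (cscale zz ([:: 14; -3; 1]%coqZ, [:: -2; 1]%coqZ, [:: -3; 1]%coqZ)))).

Definition kadd (u v : kelt) : kelt := (cadd u.1 v.1, cadd u.2 v.2).

Definition kmul (u v : kelt) : kelt :=
  (cadd (cmul u.1 v.1) (cscale [:: -56; 28; -7]%coqZ (cmul u.2 v.2)),
   cadd (cmul u.1 v.2) (cmul u.2 v.1)).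

Definition kpoly (p : tpoly) : kelt := ((p, [::], [::]), ([::], [::], [::])).

Definition kzero (u : kelt) : bool :=
  let: ((a, b, c), (a', b', c')) := u in
  [&& tzero a, tzero b, tzero c, tzero a', tzero b' & tzero c'].

Definition keq (u v : kelt) : bool := kzero (kadd u (kmul (kpoly [:: -1]%coqZ) v)).

Definition ksum7 (f : nat -> kelt) : kelt :=
  foldr (fun k => kadd (f k)) (kpoly [::]) (iota 0 7).

(* Let [r_0, .., r_6] be the roots of the septic in the cyclic order given by
   the Galois group over [K], and [theta_i = r_i + 1].  Entry [i] of row [j] is
   the coefficient of [theta_i] in [98 r_0 theta_j], found numerically by
   interpolation in [t]. *)
Definition septic_table : seq (seq kelt) := Eval compute in
  let E a b c a' b' c' := ((a, b, c), (a', b', c')) : kelt in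
  let K0 := kpoly [::] in ([::
  [:: E [:: 588; -546; 196; -42] [::] [::] [::] [::] [::];
      E [:: -196; 91; -21] [:: -56; 21] [:: 56; -56; 21] [:: 49; -23; 12] [:: 1; -6] [:: 12; -9];
      E [:: -196; 147; -77; 21] [:: -56; 56; -21] [:: -112; 77; -21] [:: 49; -11; 3] [:: -12; 9] [:: -11; 3];
      E [:: -196; 35] [:: 112; -77; 21] [:: 56; -21] [:: -49; 22; -6] [:: -11; 3] [:: 1; -6];
      E [:: -196; 35] [:: 112; -77; 21] [:: 56; -21] [:: 49; -22; 6] [:: 11; -3] [:: -1; 6];
      E [:: -196; 147; -77; 21] [:: -56; 56; -21] [:: -112; 77; -21] [:: -49; 11; -3] [:: 12; -9] [:: 11; -3];
      E [:: -196; 91; -21] [:: -56; 21] [:: 56; -56; 21] [:: -49; 23; -12] [:: -1; 6] [:: -12; 9]];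
  [:: E [:: 0; 63; -21; 7] [:: 84; -49; 7] [:: 0; 14; -7] [:: 7; 1; 1] [:: -11; 3] [:: -6; 1];
      E [:: -98; 63; -21; 7] [:: 84; -49; 7] [:: 0; 14; -7] [:: -7; -1; -1] [:: 11; -3] [:: 6; -1];
      E [:: -196; 175; -56; 7] [:: -84; 14] [:: -70; 7] [:: -21; 4; -3] [:: 12; -2] [:: -3; 4];
      E [:: 98; -77; 35; -7] [:: -84; 35; -7] [:: 0; 7] [:: -35; 23; -5] [:: -1; -1] [:: -5; 2];
      E [:: 392; -224; 84; -14] [:: -28] [:: 42; -56; 14] [::] [::] [::];
      E [:: 98; -77; 35; -7] [:: -84; 35; -7] [:: 0; 7] [:: 35; -23; 5] [:: 1; 1] [:: 5; -2];
      E [:: -196; 175; -56; 7] [:: -84; 14] [:: -70; 7] [:: 21; -4; 3] [:: -12; 2] [:: 3; -4]];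
  [:: E [:: 0; 63; -7] [:: 0; -14; 7] [:: 84; -63; 14] [:: 7; -5; 2] [:: 6; -1] [:: -5; 2];
      E [:: 392; -182; 28] [:: -42; 56; -14] [:: -70; 56; -14] [::] [::] [::];
      E [:: -98; 63; -7] [:: 0; -14; 7] [:: 84; -63; 14] [:: -7; 5; -2] [:: -6; 1] [:: 5; -2];
      E [:: 98; -77; 42; -7] [:: 0; -7] [:: -84; 28; -7] [:: 35; -18; 3] [:: -5; 2] [:: -4; 3];
      E [:: -196; 105; -49; 7] [:: 70; -7] [:: -14; 7] [:: -21; 1; 1] [:: 3; -4] [:: 15; -6];
      E [:: -196; 105; -49; 7] [:: 70; -7] [:: -14; 7] [:: 21; -1; -1] [:: -3; 4] [:: -15; 6];
      E [:: 98; -77; 42; -7] [:: 0; -7] [:: -84; 28; -7] [:: -35; 18; -3] [:: 5; -2] [:: 4; -3]];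
  [:: E [:: 0; 147; -70; 14] [:: -84; 63; -14] [:: -84; 49; -7] [:: -7; 10; -4] [:: -5; 2] [:: -11; 3];
      E [:: 98; -161; 70; -14] [:: 84; -28; 7] [:: 84; -35; 7] [:: -35; 22; -6] [:: -4; 3] [:: 1; 1];
      E [:: 98; -161; 70; -14] [:: 84; -28; 7] [:: 84; -35; 7] [:: 35; -22; 6] [:: 4; -3] [:: -1; -1];
      E [:: -98; 147; -70; 14] [:: -84; 63; -14] [:: -84; 49; -7] [:: 7; -10; 4] [:: 5; -2] [:: 11; -3];
      E [:: -196; 91; -42; 7] [:: 14; -7] [:: 84; -14] [:: -21; 16; -5] [:: -15; 6] [:: -12; 2];
      E [:: 392; -252; 84; -14] [:: 70; -56; 14] [:: 28] [::] [::] [::];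
      E [:: -196; 91; -42; 7] [:: 14; -7] [:: 84; -14] [:: 21; -16; 5] [:: 15; -6] [:: 12; -2]];
  [:: E [:: 0; 147; -70; 14] [:: -84; 63; -14] [:: -84; 49; -7] [:: 7; -10; 4] [:: 5; -2] [:: 11; -3];
      E [:: -196; 91; -42; 7] [:: 14; -7] [:: 84; -14] [:: -21; 16; -5] [:: -15; 6] [:: -12; 2];
      E [:: 392; -252; 84; -14] [:: 70; -56; 14] [:: 28] [::] [::] [::];
      E [:: -196; 91; -42; 7] [:: 14; -7] [:: 84; -14] [:: 21; -16; 5] [:: 15; -6] [:: 12; -2];
      E [:: -98; 147; -70; 14] [:: -84; 63; -14] [:: -84; 49; -7] [:: -7; 10; -4] [:: -5; 2] [:: -11; 3];
      E [:: 98; -161; 70; -14] [:: 84; -28; 7] [:: 84; -35; 7] [:: -35; 22; -6] [:: -4; 3] [:: 1; 1];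
      E [:: 98; -161; 70; -14] [:: 84; -28; 7] [:: 84; -35; 7] [:: 35; -22; 6] [:: 4; -3] [:: -1; -1]];
  [:: E [:: 0; 63; -7] [:: 0; -14; 7] [:: 84; -63; 14] [:: -7; 5; -2] [:: -6; 1] [:: 5; -2];
      E [:: 98; -77; 42; -7] [:: 0; -7] [:: -84; 28; -7] [:: 35; -18; 3] [:: -5; 2] [:: -4; 3];
      E [:: -196; 105; -49; 7] [:: 70; -7] [:: -14; 7] [:: -21; 1; 1] [:: 3; -4] [:: 15; -6];
      E [:: -196; 105; -49; 7] [:: 70; -7] [:: -14; 7] [:: 21; -1; -1] [:: -3; 4] [:: -15; 6];
      E [:: 98; -77; 42; -7] [:: 0; -7] [:: -84; 28; -7] [:: -35; 18; -3] [:: 5; -2] [:: 4; -3];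
      E [:: -98; 63; -7] [:: 0; -14; 7] [:: 84; -63; 14] [:: 7; -5; 2] [:: 6; -1] [:: -5; 2];
      E [:: 392; -182; 28] [:: -42; 56; -14] [:: -70; 56; -14] [::] [::] [::]];
  [:: E [:: 0; 63; -21; 7] [:: 84; -49; 7] [:: 0; 14; -7] [:: -7; -1; -1] [:: 11; -3] [:: 6; -1];
      E [:: -196; 175; -56; 7] [:: -84; 14] [:: -70; 7] [:: -21; 4; -3] [:: 12; -2] [:: -3; 4];
      E [:: 98; -77; 35; -7] [:: -84; 35; -7] [:: 0; 7] [:: -35; 23; -5] [:: -1; -1] [:: -5; 2];
      E [:: 392; -224; 84; -14] [:: -28] [:: 42; -56; 14] [::] [::] [::];
      E [:: 98; -77; 35; -7] [:: -84; 35; -7] [:: 0; 7] [:: 35; -23; 5] [:: 1; 1] [:: 5; -2];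
      E [:: -196; 175; -56; 7] [:: -84; 14] [:: -70; 7] [:: 21; -4; 3] [:: -12; 2] [:: 3; -4];
      E [:: -98; 63; -21; 7] [:: 84; -49; 7] [:: 0; 14; -7] [:: 7; 1; 1] [:: -11; 3] [:: -6; 1]]])%coqZ.

Definition kentry (A : seq (seq kelt)) (i j : nat) : kelt :=
  nth (kpoly [::]) (nth [::] A i) j.

(** The cyclic automorphism shifts all indices, so this is the matrix of 98 r_k; the [+ 7] keeps the
    truncated subtraction exact. *)
Definition septic_mult (k : nat) : seq (seq kelt) :=
  mkseq (fun i => mkseq (fun j =>
    kentry septic_table ((i + 7 - k) %% 7) ((j + 7 - k) %% 7)) 7) 7.

Definition kcommute (A B : seq (seq kelt)) : bool :=
  all (fun i => all (fun j =>
    keq (ksum7 (fun l => kmul (kentry A i l) (kentry B l j)))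
        (ksum7 (fun l => kmul (kentry B i l) (kentry A l j))))
    (iota 0 7)) (iota 0 7).

Definition septic_coefs : seq tpoly :=
  [:: [:: 1224; -1584; 410; -94; -20; -1];
      [:: 924; 476; -161; 70];
      [:: -504; -84; 56; -35];
      [:: 420; -84; 28];
      [:: -70; 28; -7];
      [:: 21]; [::]; [:: 1]]%coqZ.

(* [98 ^ size l] times the row [(1, .., 1)] times the value at [A / 98] of the
   polynomial with coefficients [l]. *)
Fixpoint kmxhorner (A : seq (seq kelt)) (l : seq tpoly) : seq kelt :=
  if l is c :: l' then
    let v := kmxhorner A l' in
    mkseq (fun j =>
      kadd (ksum7 (fun i => kmul (nth (kpoly [::]) v i) (kentry A i j)))
        (kmul (kpoly [:: (98 ^ Z.of_nat (size l))%coqZ]) (kpoly c))) 7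
  else nseq 7 (kpoly [::]).

(** The theta_i sum to 7, so the row (1, .., 1) stands for 7, and 7 r_k = 7 theta_k - 7 is 6 theta_k
    minus the other theta_i. The factor 98 of the table turns 6 and -1 into 588 and -98. *)
Definition kcolsums (k : nat) (A : seq (seq kelt)) : bool :=
  all (fun j => keq (ksum7 (fun i => kentry A i j))
                    (kpoly [:: if j == k then 588 else -98]%coqZ)) (iota 0 7).

Lemma septic_certificate :
  all (fun k => kcommute (septic_mult 0) (septic_mult k)
    && kcolsums k (septic_mult k)) (iota 0 7).
Proof. by vm_compute. Qed.

Lemma septic_horner_certificate : all kzero (kmxhorner (septic_mult 0) septic_coefs).
Proof. by vm_compute. Qed.

Lemma all_iotaP n (P : pred nat) (i : 'I_n) : all P (iota 0 n) -> P i.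
Proof. by move=> /(@allP nat) h; apply: h; rewrite mem_iota add0n ltn_ord. Qed.

(** * Soundness of the formal arithmetic *)

Section SepticInterpretation.

Variables (R : comNzRingType) (t y z s : R).
Hypothesis yyE : y * y = (2 * t ^+ 2 - 5 * t + 14) - y + (2 - t) * z.
Hypothesis yzE : y * z = - t ^+ 2 + t - 7 + 3 * y + (t + 1) * z.
Hypothesis zzE : z * z = t ^+ 2 - 3 * t + 14 + (t - 2) * y + (t - 3) * z.
Hypothesis ssE : s * s = - 7 * t ^+ 2 + 28 * t - 56.

Definition zeval (a : Z) : R := (int_of_Z a)%:~R.

Definition teval (p : tpoly) : R := foldr (fun a r => zeval a + t * r) 0 p.

Definition ceval (u : celt) : R :=
  let: (a, b, c) := u in teval a + teval b * y + teval c * z.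

Definition keval (u : kelt) : R := ceval u.1 + ceval u.2 * s.

Lemma zevalD a b : zeval (Z.add a b) = zeval a + zeval b.
Proof. by rewrite /zeval (rmorphD int_of_Z) rmorphD. Qed.

Lemma zevalM a b : zeval (Z.mul a b) = zeval a * zeval b.
Proof. by rewrite /zeval (rmorphM int_of_Z) rmorphM. Qed.

Lemma tevalD p q : teval (tadd p q) = teval p + teval q.
Proof.
elim: p q => [|a p IH] [|b q] //=; rewrite ?add0r ?addr0 //.
by rewrite zevalD IH; ring.
Qed.

Lemma tevalZ a p : teval (tscale a p) = zeval a * teval p.
Proof. by elim: p => [|b p /= ->]; rewrite /= ?mulr0 // zevalM; ring. Qed.

Lemma tevalM p q : teval (tmul p q) = teval p * teval q.
Proof.
elim: p => [|a p IH] /=; first by rewrite mul0r.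
by rewrite tevalD tevalZ /= IH (_ : zeval Z0 = 0) //; ring.
Qed.

Lemma tzeroP p : tzero p -> teval p = 0.
Proof.
elim: p => //= a p IH /andP[]; case: a => // _ /IH ->.
by rewrite mulr0 addr0.
Qed.

Lemma cevalD u v : ceval (cadd u v) = ceval u + ceval v.
Proof. by case: u v => [[a b] c] [[a' b'] c'] /=; rewrite !tevalD; ring. Qed.

Lemma cevalZ p u : ceval (cscale p u) = teval p * ceval u.
Proof. by case: u => [[a b] c] /=; rewrite !tevalM; ring. Qed.

Lemma cevalM u v : ceval (cmul u v) = ceval u * ceval v.
Proof.
case: u v => [[a b] c] [[a' b'] c']; rewrite /cmul !(cevalD, cevalZ) /=.
rewrite !(tevalD, tevalM) /=.
have -> : (teval a + teval b * y + teval c * z) *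
  (teval a' + teval b' * y + teval c' * z) =
  teval a * teval a' + (teval a * teval b' + teval b * teval a') * y
  + (teval a * teval c' + teval c * teval a') * z
  + teval b * teval b' * (y * y) + (teval b * teval c' + teval c * teval b') * (y * z)
  + teval c * teval c' * (z * z) by ring.
by rewrite yyE yzE zzE /zeval; ring.
Qed.

Lemma kevalD u v : keval (kadd u v) = keval u + keval v.
Proof. by rewrite /keval !cevalD; ring. Qed.

Lemma kevalM u v : keval (kmul u v) = keval u * keval v.
Proof.
rewrite /keval /= !(cevalD, cevalZ) !cevalM /=.
have -> : (ceval u.1 + ceval u.2 * s) * (ceval v.1 + ceval v.2 * s) =
  ceval u.1 * ceval v.1 + (ceval u.1 * ceval v.2 + ceval u.2 * ceval v.1) * s
  + ceval u.2 * ceval v.2 * (s * s) by ring.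
by rewrite ssE /zeval; ring.
Qed.

Lemma keval_poly p : keval (kpoly p) = teval p.
Proof. by rewrite /keval /=; ring. Qed.

Lemma kzeroP u : kzero u -> keval u = 0.
Proof.
case: u => [[[a b] c] [[a' b'] c']] /and5P[/tzeroP ha /tzeroP hb /tzeroP hc].
move=> /tzeroP ha' /andP[/tzeroP hb' /tzeroP hc'].
by rewrite /keval /= ha hb hc ha' hb' hc'; ring.
Qed.

Lemma keqP u v : keq u v -> keval u = keval v.
Proof.
move/kzeroP; rewrite kevalD kevalM keval_poly /= /zeval /= => /eqP.
by rewrite mulr0 addr0 mulN1r subr_eq0 => /eqP.
Qed.

Lemma keval_sum7 f : keval (ksum7 f) = \sum_(i < 7) keval (f i).
Proof.
by rewrite /ksum7 /= !kevalD keval_poly !big_ord_recl big_ord0.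
Qed.

Definition kmx (A : seq (seq kelt)) : 'M[R]_7 :=
  \matrix_(i, j) keval (kentry A i j).

Lemma kmx_comm A B : kcommute A B -> comm_mx (kmx A) (kmx B).
Proof.
move=> h; apply/matrixP => i j; rewrite !mxE.
have /keqP := all_iotaP j (all_iotaP i h); rewrite !keval_sum7 => hij.
under eq_bigr => l _ do rewrite !mxE -kevalM.
by rewrite hij; apply: eq_bigr => l _; rewrite !mxE kevalM.
Qed.

Lemma kmx_colsums k A : kcolsums k A ->
  const_mx 1 *m kmx A = \row_(j < 7) if j == k :> nat then 588 else - 98.
Proof.
move=> h; apply/rowP => j; rewrite !mxE.
have /keqP := all_iotaP j h; rewrite keval_sum7 keval_poly => hj.
under eq_bigr => l _ do rewrite !mxE mul1r.
by rewrite hj /=; case: ifP => _; rewrite /zeval /= mulr0 addr0.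
Qed.

End SepticInterpretation.

(** * Commuting matrices annihilated by the septic *)

Section SepticMatrices.

Variables (F : fieldType) (t y z s : F).
Hypothesis yyE : y * y = (2 * t ^+ 2 - 5 * t + 14) - y + (2 - t) * z.
Hypothesis yzE : y * z = - t ^+ 2 + t - 7 + 3 * y + (t + 1) * z.
Hypothesis zzE : z * z = t ^+ 2 - 3 * t + 14 + (t - 2) * y + (t - 3) * z.
Hypothesis ssE : s * s = - 7 * t ^+ 2 + 28 * t - 56.
Hypothesis n98 : 98 != 0 :> F.

Lemma zeval98X n : zeval F (98 ^ Z.of_nat n)%coqZ = 98 ^+ n.
Proof.
elim: n => [|n IH]; first by rewrite /zeval /= expr0.
by rewrite Nat2Z.inj_succ Z.pow_succ_r ?zevalM ?IH ?exprS //; exact: Nat2Z.is_nonneg.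
Qed.

Lemma kmxhorner_val A l :
  \row_(j < 7) keval t y z s (nth (kpoly [::]) (kmxhorner A l) j) =
  98 ^+ size l *:
    (const_mx 1 *m horner_mx (98^-1 *: kmx t y z s A) (Poly (map (teval t) l))).
Proof.
elim: l => [|c l IH].
  rewrite [Poly _]/= polyC0 raddf0 mulmx0 scaler0.
  rewrite -[kmxhorner A [::]]/(nseq 7 (kpoly [::])).
  by apply/rowP => j; rewrite !mxE nth_nseq ltn_ord keval_poly.
rewrite map_cons /= cons_poly_def rmorphD rmorphM /= horner_mx_X horner_mx_C.
rewrite mulmxDr mul_mx_scalar -mulmxE mulmxA -scalemxAr scalerDr scalerA exprSr mulfK //.
rewrite scalemxAl -IH; apply/rowP => j.
rewrite !mxE nth_mkseq // (kevalD t y z s) keval_sum7 (kevalM yyE yzE zzE ssE) !keval_poly.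
congr (_ + _).
  by apply: eq_bigr => i _; rewrite !mxE (kevalM yyE yzE zzE ssE).
have /= -> := zeval98X (size l).+1.
by rewrite mulr0 addr0 mulr1 exprSr.
Qed.

End SepticMatrices.

Lemma zeval1 (R : comNzRingType) : zeval R (Zpos xH) = 1.
Proof. by []. Qed.

(** Unfolds binary literals into sums and products that [ring] can read. *)
Lemma zevalE (R : comNzRingType) p :
  (zeval R (Zpos (xO p)) = 2 * zeval R (Zpos p)) *
  (zeval R (Zpos (xI p)) = 2 * zeval R (Zpos p) + 1) *
  (zeval R (Zneg p) = - zeval R (Zpos p)).
Proof.
have h q : zeval R (Zpos (xO q)) = 2 * zeval R (Zpos q).
  by rewrite -(zevalM R 2%coqZ (Zpos q)).
do !split => //; last by rewrite -mulN1r -(zevalM R (Zneg xH) (Zpos p)).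
by rewrite -h -(zevalD R (Zpos (xO p)) 1%coqZ).
Qed.

Lemma horner_mx_intertwine (R : comNzRingType) n (S A B : 'M[R]_n.+1) (p : {poly R}) :
  S *m A = B *m S -> S *m horner_mx A p = horner_mx B p *m S.
Proof.
move=> SA; elim/poly_ind: p => [|p c IH]; first by rewrite !rmorph0 mulmx0 mul0mx.
rewrite !(rmorphD, rmorphM) /= !horner_mx_X !horner_mx_C -!mulmxE mulmxDr mulmxDl.
by rewrite mulmxA IH -!mulmxA SA scalar_mxC.
Qed.

(** [S] is a permutation matrix, so it fixes the row (1, .., 1); the Horner certificate, computed
    for one matrix only, thereby carries over to all seven. *)
Lemma septic_mult_shift (R : comNzRingType) (t y z s : R) (k : 'I_7) :
  exists2 S : 'M[R]_7, const_mx 1 *m S = const_mx 1 :> 'rV_7 &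
    S *m kmx t y z s (septic_mult k) = kmx t y z s (septic_mult 0) *m S.
Proof.
have entryE l i j : (i < 7)%N -> (j < 7)%N -> kentry (septic_mult l) i j =
    kentry septic_table ((i + 7 - l) %% 7)%N ((j + 7 - l) %% 7)%N.
  by move=> lti ltj; rewrite [in LHS]/kentry /septic_mult !nth_mkseq.
pose sh := perm (addIr k); exists (perm_mx sh).
  by rewrite -[sh]invgK -col_permE; apply/rowP => j; rewrite !mxE.
have shE (i : 'I_7) : sh i = ((i + k) %% 7)%N :> nat by rewrite permE.
apply/matrixP => i j; rewrite -row_permE -{2}[sh]invgK -col_permE.
rewrite mxE [RHS]mxE -{1}[j](permKV sh); move: ((sh^-1)%g j) => j'.
rewrite !mxE !entryE ?ltn_ord // !shE.
have shift (l : 'I_7) : (((l + k) %% 7 + 7 - k) %% 7 = (l + 7 - 0) %% 7)%N.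
  by have := ltn_ord l; have := ltn_ord k; lia.
by rewrite !shift.
Qed.

Lemma septic_mult_matrices (F : fieldType) (t : int) (y z s : F)
  (yyE : y * y = (2 * t%:~R ^+ 2 - 5 * t%:~R + 14) - y + (2 - t%:~R) * z)
  (yzE : y * z = - t%:~R ^+ 2 + t%:~R - 7 + 3 * y + (t%:~R + 1) * z)
  (zzE : z * z =
    t%:~R ^+ 2 - 3 * t%:~R + 14 + (t%:~R - 2) * y + (t%:~R - 3) * z)
  (ssE : s * s = - 7 * t%:~R ^+ 2 + 28 * t%:~R - 56) (n98 : 98 != 0 :> F) :
  exists M : 'I_7 -> 'M[F]_7,
  [/\ forall k, comm_mx (M ord0) (M k),
      forall k, const_mx 1 *m
        horner_mx (M k) (map_poly (intr : int -> F) (septic t)) = 0 :> 'rV_7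
    & forall k, const_mx 1 *m M k = \row_(j < 7) if j == k then 6 else - 1].
Proof.
exists (fun k => 98^-1 *: kmx t%:~R y z s (septic_mult k)).
have cert (k : 'I_7) := all_iotaP k septic_certificate.
split=> k; have /andP[hc hs] := cert k.
- rewrite /comm_mx -!scalemxAl -!scalemxAr; congr (_ *: (_ *: _)).
  exact: kmx_comm hc.
- have pE : map_poly (intr : int -> F) (septic t) =
      Poly (map (teval t%:~R) septic_coefs).
    apply/polyP => i; rewrite coef_map coef_Poly /septic !coefE.
    case: i => [|[|[|[|[|[|[|[|i]]]]]]]];
      rewrite /= ?nth_nil ?mulr0 ?mulr1 ?zevalE ?zeval1; ring.
  have [S uS SM] := septic_mult_shift t%:~R y z s k.
  rewrite -uS -mulmxA (@horner_mx_intertwine _ _ S _ (98^-1 *: kmx t%:~R y z s (septic_mult 0)));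
    last by rewrite -scalemxAl -scalemxAr SM.
  rewrite mulmxA pE.
  suff -> : const_mx 1 *m horner_mx (98^-1 *: kmx t%:~R y z s (septic_mult 0))
    (Poly (map (teval t%:~R) septic_coefs)) = 0 :> 'rV[F]_7 by rewrite mul0mx.
  apply: (scalerI (expf_neq0 (size septic_coefs) n98)); rewrite scaler0.
  rewrite -(kmxhorner_val yyE yzE zzE ssE n98); apply/rowP => j; rewrite !mxE.
  apply: kzeroP; apply: (allP septic_horner_certificate); apply: mem_nth.
  by have -> : size (kmxhorner (septic_mult 0) septic_coefs) = 7%N by exact: size_mkseq.
- rewrite -scalemxAr (kmx_colsums yyE yzE zzE ssE hs).
  apply/rowP => j; rewrite !mxE; apply: (mulfI n98); rewrite mulrA mulfV // mul1r.
  by rewrite -val_eqE /=; case: ifP => _; ring.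
Qed.

(** As [p] is irreducible and kills [u] through [M0], it generates the annihilator of [u]. Hence the
    rows [u *m M0 ^+ i] with [i <= m] are a basis, and [r] consists of the coordinates of [u *m M1]
    in it. Commutation gives [u *m M1 ^+ k = u *m horner_mx M0 (r ^+ k)], so [p \Po r] also kills
    [u]. *)
Lemma mx_poly_root (F : fieldType) m (p : {poly F}) (u : 'rV[F]_m.+1)
  (M0 M1 : 'M[F]_m.+1) : irreducible_poly p -> size p = m.+2 -> u != 0 ->
  comm_mx M0 M1 -> u *m horner_mx M0 p = 0 -> u *m horner_mx M1 p = 0 ->
  exists r : {poly F}, [/\ (size r <= m.+1)%N, u *m M1 = u *m horner_mx M0 r
    & p %| p \Po r].
Proof.
move=> [p1 irr_p] sz_p nz_u cM up0 up1.
have ann q : u *m horner_mx M0 q = 0 -> p %| q.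
  move=> uq; have [cpq|] := boolP (coprimep p q).
    have /Bezout_eq1_coprimepP[[a b] /= ab] := cpq.
    case/eqP: nz_u; rewrite -[u]mulmx1 -(horner_mx_C M0) polyC1 -ab [a * p]mulrC.
    by rewrite [b * q]mulrC rmorphD !rmorphM /= mulmxDr !mulmxA up0 uq !mul0mx addr0.
  rewrite /coprimep => /irr_p /(_ (dvdp_gcdl _ _)) e.
  by rewrite -(eqp_dvdl _ e) dvdp_gcdr.
pose B := \matrix_(i < m.+1) (u *m M0 ^+ i).
have BE (c : 'rV_m.+1) : c *m B = u *m horner_mx M0 (rVpoly c).
  rewrite mulmx_sum_row [rVpoly c]/rVpoly poly_def raddf_sum mulmx_sumr /=.
  apply: eq_bigr => i _; rewrite insubT // => lt_i; rewrite linearZ /= -scalemxAr.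
  rewrite rowK rmorphXn /= horner_mx_X; congr (c _ _ *: _); exact: val_inj.
have unitB : B \in unitmx.
  rewrite -row_free_unit; apply: inj_row_free => v; rewrite BE => /ann pv.
  apply: (can_inj rVpolyK); rewrite linear0; apply/eqP; apply: contraTT pv => nz_v.
  by rewrite gtNdvdp // sz_p ltnS size_poly.
pose r := rVpoly (u *m M1 *m invmx B).
have rE : u *m M1 = u *m horner_mx M0 r by rewrite -BE mulmxKV.
exists r; split=> //; first exact: size_poly.
apply: ann; rewrite -up1.
have uX k : u *m M1 ^+ k = u *m horner_mx M0 (r ^+ k).
  elim: k => [|k IH]; first by rewrite !expr0 rmorph1.
  rewrite exprSr -mulmxE mulmxA IH -mulmxA (comm_horner_mx _ cM) mulmxA rE -mulmxA.
  by rewrite mulmxE -rmorphM /= exprS.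
have -> : u *m horner_mx M1 p = \sum_(i < size p) p`_i *: (u *m M1 ^+ i).
  rewrite -{1}[p]coefK poly_def raddf_sum mulmx_sumr; apply: eq_bigr => i _.
  by rewrite /= horner_mxZ -scalemxAr rmorphXn /= horner_mx_X.
rewrite comp_polyE raddf_sum mulmx_sumr; apply: eq_bigr => i _.
by rewrite /= horner_mxZ -scalemxAr uX.
Qed.

(** * Prime degree fields generated by one root *)

Lemma adjoin_degree1_irreducible (F : fieldType) (L : fieldExtType F)
  (p : {poly F}) (x : L) : irreducible_poly p ->
  root (map_poly (in_alg L) p) x -> (adjoin_degree 1 x).+1 = size p.
Proof.
move=> [p1 irr_p] px; rewrite -size_minPoly.
have /polyOver1P[q qE] := minPolyOver 1%AS x.
have : q %| p.
  rewrite -(dvdp_map (in_alg L)) -qE; apply: minPoly_dvdp px.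
  by apply/polyOver1P; exists p.
have szq : size q = size (minPoly 1 x) by rewrite qE size_map_poly.
move/irr_p; rewrite szq => /(_ _)/eqp_size <- //.
by rewrite size_minPoly eqSS -lt0n.
Qed.

Lemma map_poly_intr_alg (L : fieldExtType rat) (p : {poly int}) :
  map_poly (in_alg L) (map_poly (intr : int -> rat) p) =
  map_poly (intr : int -> L) p.
Proof. by rewrite -map_poly_comp; apply: eq_map_poly => a; exact: (rmorph_int (in_alg L)). Qed.

Lemma intr_polyOver (L : fieldExtType rat) (K : {subfield L}) (p : {poly int}) :
  map_poly (intr : int -> L) p \is a polyOver K.
Proof. by apply/polyOverP => i; rewrite coef_map rpred_int. Qed.

Lemma cyclic_of_generating_root (L : splittingFieldType rat) (K E : {subfield L})
  (p : {poly L}) (x : L) : p \is a polyOver K -> separable_poly p ->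
  splittingFieldFor K p E -> <<K; x>>%VS = E -> prime (adjoin_degree K x) ->
  cyclic_extension K E.
Proof.
move=> Kp sep_p split_p defE prime_x.
have galKE : galois K E by apply/splitting_galoisField; exists p.
split=> //; apply: prime_cyclic.
by rewrite -galois_dim // -defE -adjoin_degreeE.
Qed.

Lemma splittingField_generating_root (F : fieldType) (L : fieldExtType F)
  (K E : {subfield L}) (p : {poly L}) (x : L) (rs : seq L) :
  p \is monic -> splittingFieldFor K p E -> uniq rs -> size p = (size rs).+1 ->
  all (root p) rs -> root p x -> {subset rs <= <<K; x>>%VS} ->
  separable_poly p /\ <<K; x>>%VS = E.
Proof.
move=> mon_p [rs' p_rs' <-] uniq_rs szp prs px Krs.
have pE : p = \prod_(r <- rs) ('X - r%:P).
  apply/eqP; rewrite -eqp_monic ?monic_prod_XsubC //.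
  rewrite eqp_sym -dvdp_size_eqp ?size_prod_XsubC ?szp //.
  by apply: uniq_roots_dvdp => //; rewrite uniq_rootsE.
have eq_rs : rs =i rs'.
  by move=> r; rewrite -!root_prod_XsubC -pE; apply/eqp_root.
split; first by rewrite pE separable_prod_XsubC.
apply/eqP; rewrite eqEsubv; apply/andP; split.
  by apply/FadjoinP; split; [exact: subv_adjoin_seq | apply: seqv_sub_adjoin; rewrite -eq_rs -root_prod_XsubC -pE].
apply/Fadjoin_seqP; split; first exact: subv_adjoin.
by move=> r; rewrite -eq_rs; exact: Krs.
Qed.

(** * The cyclic cubic field *)

Lemma map_cubic (R : comNzRingType) (t : int) :
  map_poly (intr : int -> R) (cubic t) =
  'X^3 - t%:~R%:P * 'X^2 - (2 * t%:~R ^+ 2 - 7 * t%:~R + 21)%:P * 'X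
  + (t%:~R ^+ 3 + 28)%:P.
Proof.
apply/polyP => i; rewrite coef_map /cubic !(coefE, coefCM).
by case: i => [|[|[|[|i]]]]; rewrite /= ?mulr0 ?mulr1; ring.
Qed.

Lemma root_cubicE (R : comNzRingType) (t : int) (y : R) :
  root (map_poly (intr : int -> R) (cubic t)) y ->
  y ^+ 3 = t%:~R * y ^+ 2 + (2 * t%:~R ^+ 2 - 7 * t%:~R + 21) * y
    - (t%:~R ^+ 3 + 28).
Proof.
rewrite map_cubic /root !(hornerD, hornerN, hornerM, hornerC, hornerXn, hornerX) => /eqP h; apply/subr0_eq.
by rewrite -[RHS]h; ring.
Qed.

Section CubicConjugate.

Variables (F : fieldType) (t : int) (y z : F).
Hypothesis y_root : root (map_poly (intr : int -> F) (cubic t)) y.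
Hypothesis t_neq2 : 2 - t%:~R != 0 :> F.
Hypothesis zE :
  (2 - t%:~R) * z = y ^+ 2 + y - (2 * t%:~R ^+ 2 - 5 * t%:~R + 14).

(** Expressing the conjugate [z] through [y] alone costs a division by 2 - t. With 1, y, z as
    generators all three products have coefficients in Z[t], as the formal arithmetic requires. *)
Lemma cubic_yyE :
  y * y = (2 * t%:~R ^+ 2 - 5 * t%:~R + 14) - y + (2 - t%:~R) * z.
Proof. by rewrite zE; ring. Qed.

Lemma cubic_yzE :
  y * z = - t%:~R ^+ 2 + t%:~R - 7 + 3 * y + (t%:~R + 1) * z.
Proof.
apply: (mulfI t_neq2).
have -> : (2 - t%:~R) * (y * z) = y * ((2 - t%:~R) * z) by ring.
have -> : (2 - t%:~R) * (- t%:~R ^+ 2 + t%:~R - 7 + 3 * y + (t%:~R + 1) * z) =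
  (2 - t%:~R) * (- t%:~R ^+ 2 + t%:~R - 7 + 3 * y)
  + (t%:~R + 1) * ((2 - t%:~R) * z) by ring.
rewrite zE; apply: subr0_eq; move/eqP: (root_cubicE y_root).
by rewrite -subr_eq0 => /eqP h; rewrite -[RHS]h; ring.
Qed.

Lemma cubic_zzE : z * z = t%:~R ^+ 2 - 3 * t%:~R + 14 + (t%:~R - 2) * y
  + (t%:~R - 3) * z.
Proof.
apply: (mulfI t_neq2); rewrite mulrA zE.
have -> : (y ^+ 2 + y - (2 * t%:~R ^+ 2 - 5 * t%:~R + 14)) * z =
    y * (y * z) + y * z - (2 * t%:~R ^+ 2 - 5 * t%:~R + 14) * z by ring.
rewrite cubic_yzE.
have -> : y * (- t%:~R ^+ 2 + t%:~R - 7 + 3 * y + (t%:~R + 1) * z) =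
  (- t%:~R ^+ 2 + t%:~R - 7) * y + 3 * (y * y) + (t%:~R + 1) * (y * z) by ring.
by rewrite cubic_yyE cubic_yzE; ring.
Qed.

Lemma map_cubic_factor : map_poly (intr : int -> F) (cubic t) =
  ('X - y%:P) * ('X - z%:P) * ('X - (t%:~R - y - z)%:P).
Proof.
have e2 : y * z + (y + z) * (t%:~R - y - z) = - (2 * t%:~R ^+ 2 - 7 * t%:~R + 21).
  have -> : y * z + (y + z) * (t%:~R - y - z) =
    (y + z) * t%:~R - y * y - z * z - y * z by ring.
  by rewrite cubic_yyE cubic_zzE cubic_yzE; ring.
have e3 : y * z * (t%:~R - y - z) = - (t%:~R ^+ 3 + 28).
  rewrite cubic_yzE.
  have -> : (- t%:~R ^+ 2 + t%:~R - 7 + 3 * y + (t%:~R + 1) * z) * (t%:~R - y - z)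
    = (- t%:~R ^+ 2 + t%:~R - 7) * (t%:~R - y - z) + t%:~R * (3 * y + (t%:~R + 1) * z)
      - 3 * (y * y) - (t%:~R + 1) * (z * z) - (t%:~R + 4) * (y * z) by ring.
  by rewrite cubic_yyE cubic_zzE cubic_yzE; ring.
rewrite map_cubic.
have -> : (t%:~R ^+ 3 + 28)%:P = - (y * z * (t%:~R - y - z))%:P :> {poly F}.
  by rewrite e3 rmorphN /= opprK.
have -> : (2 * t%:~R ^+ 2 - 7 * t%:~R + 21)%:P =
  - (y * z + (y + z) * (t%:~R - y - z))%:P :> {poly F}.
  by rewrite e2 rmorphN /= opprK.
by rewrite !(polyCB, polyCM, polyCD); ring.
Qed.

End CubicConjugate.

Lemma map_cubicE (R : comNzRingType) (t : int) :
  map_poly (intr : int -> R) (cubic t) = \poly_(i < 4)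
  [:: t%:~R ^+ 3 + 28; - (2 * t%:~R ^+ 2 - 7 * t%:~R + 21); - t%:~R; 1]`_i.
Proof.
rewrite map_cubic; apply/polyP => i; rewrite !(coefE, coefCM).
by case: i => [|[|[|[|i]]]]; rewrite /= ?mulr0 ?mulr1 ?subr0 ?add0r ?sub0r ?addr0.
Qed.

Lemma size_map_cubic (R : comNzRingType) (t : int) :
  size (map_poly (intr : int -> R) (cubic t)) = 4%N.
Proof. by rewrite map_cubicE size_poly_eq // oner_neq0. Qed.

Lemma monic_map_cubic (R : comNzRingType) (t : int) :
  map_poly (intr : int -> R) (cubic t) \is monic.
Proof. by rewrite monicE /lead_coef size_map_cubic map_cubicE coef_poly. Qed.

Lemma map_poly_intz (p : {poly int}) : map_poly intr p = p.
Proof. by apply: map_poly_id => a _; rewrite intz. Qed.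

(** At t = 2 the cubic is (Y - 3)^2 (Y + 4). *)
Lemma cubic_irreducible_neq2 (t : int) :
  irreducible_poly (map_poly (intr : int -> rat) (cubic t)) -> t != 2.
Proof.
move=> [_ irr]; apply/eqP => t2; subst t.
have : 'X - 3%:P %| map_poly (intr : int -> rat) (cubic 2).
  rewrite dvdp_XsubCl map_cubic /root.
  by rewrite !(hornerD, hornerN, hornerM, hornerC, hornerXn, hornerX); apply/eqP; ring.
move/irr; rewrite size_XsubC => /(_ isT)/eqp_size.
by rewrite size_XsubC size_map_cubic.
Qed.

Lemma intr_fieldExt_eq0 (L : fieldExtType rat) (a : int) :
  (a%:~R == 0 :> L) = (a == 0).
Proof. by rewrite -(rmorph_int (in_alg L)) fmorph_eq0 intr_eq0. Qed.

Section CubicRoots.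

Variables (L : splittingFieldType rat) (t : int) (y : L).
Hypothesis irr_cubic : irreducible_poly (map_poly (intr : int -> rat) (cubic t)).
Hypothesis y_root : root (map_poly (intr : int -> L) (cubic t)) y.

Lemma cubic_neq2 : 2 - t%:~R != 0 :> L.
Proof.
have -> : 2 - t%:~R = (2 - t)%:~R :> L by ring.
by rewrite intr_fieldExt_eq0 subr_eq0 eq_sym cubic_irreducible_neq2.
Qed.

Lemma adjoin_degree_cubic : adjoin_degree 1 y = 3%N.
Proof.
apply: succn_inj; rewrite (adjoin_degree1_irreducible irr_cubic) ?size_map_cubic //.
by rewrite map_poly_intr_alg.
Qed.

(** Serves to separate the three roots: a coincidence between two of them is rewritten as a monic
    quadratic relation for [y], which degree 3 forbids. *)
Lemma cubic_quadratic_neq0 (b c : int) : y ^+ 2 + b%:~R * y + c%:~R != 0.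
Proof.
pose q : {poly L} := 'X^2 + (b%:~R%:P * 'X + c%:~R%:P).
have szr : (size (b%:~R%:P * 'X + c%:~R%:P : {poly L})%R < 3)%N.
  rewrite (leq_ltn_trans (size_polyD _ _)) // gtn_max.
  rewrite (leq_ltn_trans (size_polyC_leq1 _)) // andbT.
  by rewrite (leq_ltn_trans (size_polyMleq _ _)) // size_polyX addn2 ltnS ltnS size_polyC_leq1.
have szq : size q = 3%N by rewrite size_polyDl size_polyXn.
have Kq : q \is a polyOver 1%AS.
  by rewrite !(rpredD, rpredM) ?polyOverX ?polyOverXn ?polyOverC ?rpred_int.
apply/eqP => h; have := minPoly_dvdp Kq (x := y).
rewrite /root !(hornerD, hornerM, hornerC, hornerXn, hornerX) addrA h eqxx.
by rewrite gtNdvdp -?size_poly_gt0 ?szq ?size_minPoly ?adjoin_degree_cubic // => /(_ isT).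
Qed.

Lemma cubic_cyclic : cyclic_extension 1%AS <<1; y>>%AS.
Proof.
have t2 := cubic_neq2.
pose z : L := (y ^+ 2 + y - (2 * t%:~R ^+ 2 - 5 * t%:~R + 14)) / (2 - t%:~R).
have zE : (2 - t%:~R) * z = y ^+ 2 + y - (2 * t%:~R ^+ 2 - 5 * t%:~R + 14).
  by rewrite mulrC divfK.
pose rs := [:: y; z; t%:~R - y - z].
have pE : map_poly (intr : int -> L) (cubic t) = \prod_(r <- rs) ('X - r%:P).
  by rewrite !big_cons big_nil mulr1 mulrA; exact: map_cubic_factor.
have Ky : y \in <<1; y>>%VS by exact: memv_adjoin.
have Kz : z \in <<1; y>>%VS.
  by rewrite !(rpredM, rpredV, rpredD, rpredX, rpredN, rpred_int, rpred1) // rpred_nat.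
have Kw : t%:~R - y - z \in <<1; y>>%VS by rewrite !rpredB // rpred_int.
have Krs : {subset rs <= <<1; y>>%VS} by apply/allP; rewrite /= Ky Kz Kw.
have split : splittingFieldFor 1%AS (map_poly (intr : int -> L) (cubic t)) <<1; y>>%AS.
  exists rs; first by rewrite pE eqpxx.
  apply/eqP; rewrite eqEsubv; apply/andP; split.
    by apply/Fadjoin_seqP; split; [exact: subv_adjoin |].
  by apply/FadjoinP; split; [exact: subv_adjoin_seq | apply: seqv_sub_adjoin; rewrite mem_head].
apply: (cyclic_of_generating_root (intr_polyOver _ _) _ split) => //.
  rewrite pE separable_prod_XsubC /= !inE negb_or andbT.
  have nd (b c : int) : y ^+ 2 + b%:~R * y + c%:~R = 0 -> False.
    by move/eqP; apply/negP; exact: cubic_quadratic_neq0.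
  have sub0 (u v : L) : u = v -> u - v = 0 by move=> ->; rewrite subrr.
  have zE0 := sub0 _ _ zE; have yz0 := sub0 _ _ (cubic_yzE y_root t2 zE).
  apply/andP; split; first (apply/andP; split); apply/eqP => /sub0.
  - move=> h; apply: (nd (t - 1) (- (2 * t ^+ 2 - 5 * t + 14))).
    have -> : y ^+ 2 + (t - 1)%:~R * y + (- (2 * t ^+ 2 - 5 * t + 14))%:~R =
      - ((2 - t%:~R) * z - (y ^+ 2 + y - (2 * t%:~R ^+ 2 - 5 * t%:~R + 14)))
      - (2 - t%:~R) * (y - z) by ring.
    by rewrite h zE0 mulr0 oppr0 addr0.
  - move=> h; apply: (nd (5 - 2 * t) (- (2 * t ^+ 2 - 5 * t + 14) - (2 - t) * t)).
    have -> : y ^+ 2 + (5 - 2 * t)%:~R * y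
        + (- (2 * t ^+ 2 - 5 * t + 14) - (2 - t) * t)%:~R =
      - ((2 - t%:~R) * z - (y ^+ 2 + y - (2 * t%:~R ^+ 2 - 5 * t%:~R + 14)))
      + (2 - t%:~R) * (y - (t%:~R - y - z)) by ring.
    by rewrite h zE0 mulr0 oppr0 addr0.
  (* Clearing [z] with 2 - t would leave the leading coefficient 2. Multiplying by y - (t + 1)
     removes [z] through the relation for y z and keeps the quadratic monic. *)
  - move=> h; apply: (nd (5 - 2 * t) (- t ^+ 2 + 3 * t - 14)).
    have -> : y ^+ 2 + (5 - 2 * t)%:~R * y + (- t ^+ 2 + 3 * t - 14)%:~R =
      y * (z - (t%:~R - y - z)) - (t%:~R + 1) * (z - (t%:~R - y - z))
      - 2 * (y * z - (- t%:~R ^+ 2 + t%:~R - 7 + 3 * y + (t%:~R + 1) * z)) by ring.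
    by rewrite h yz0 !mulr0 !subr0.
by rewrite adjoin_degree_cubic.
Qed.

End CubicRoots.

(** * The septic over K *)

Lemma map_septicE (R : comNzRingType) (t : int) :
  map_poly (intr : int -> R) (septic t) = \poly_(i < 8)
  [:: - t%:~R ^+ 5 - 20 * t%:~R ^+ 4 - 94 * t%:~R ^+ 3 + 410 * t%:~R ^+ 2
        - 1584 * t%:~R + 1224;
      7 * (5 * t%:~R + 6) * (2 * t%:~R ^+ 2 - 7 * t%:~R + 22);
      - (7 * (5 * t%:~R ^+ 3 - 8 * t%:~R ^+ 2 + 12 * t%:~R + 72));
      28 * (t%:~R ^+ 2 - 3 * t%:~R + 15);
      - (7 * (t%:~R ^+ 2 - 4 * t%:~R + 10));
      21; 0; 1]`_i.
Proof.
apply/polyP => i; rewrite coef_map /septic !coefE.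
by case: i => [|[|[|[|[|[|[|[|i]]]]]]]]; rewrite /= ?mulr0 ?mulr1; ring.
Qed.

Lemma size_map_septic (R : comNzRingType) (t : int) :
  size (map_poly (intr : int -> R) (septic t)) = 8%N.
Proof. by rewrite map_septicE size_poly_eq // oner_neq0. Qed.

Lemma monic_map_septic (R : comNzRingType) (t : int) :
  map_poly (intr : int -> R) (septic t) \is monic.
Proof. by rewrite monicE /lead_coef size_map_septic map_septicE coef_poly. Qed.

Lemma adjoin_degree_leq (F : fieldType) (L : fieldExtType F) (K : {subfield L})
  (p : {poly L}) (x : L) : p \is a polyOver K -> p != 0 -> root p x ->
  (adjoin_degree K x < size p)%N.
Proof.
move=> Kp nz_p px; rewrite -size_minPoly; apply: dvdp_leq => //.
exact: minPoly_dvdp.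
Qed.

(** By the tower law the degree of [x] over the base field divides the product of
    [adjoin_degree K x] and [\dim K]. *)
Lemma coprime_adjoin_degree_dvdn (F : fieldType) (L : fieldExtType F)
  (K : {subfield L}) (x : L) : coprime (adjoin_degree 1 x) (\dim K) ->
  (adjoin_degree 1 x %| adjoin_degree K x)%N.
Proof.
move=> cop; rewrite -(Gauss_dvdl _ cop) -dim_Fadjoin.
have -> : adjoin_degree 1 x = \dim <<1; x>> by rewrite dim_Fadjoin dimv1 muln1.
apply: field_dimS; apply/FadjoinP; split; first exact: sub1v.
exact: memv_adjoin.
Qed.

Lemma irreducible_minPoly (F : fieldType) (L : fieldExtType F)
  (K : {subfield L}) (p : {poly subvs_of K}) (x : L) :
  map_poly vsval p = minPoly K x -> irreducible_poly p.
Proof.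
move=> pE; split.
  by rewrite -(size_map_poly (vsval : subvs_of K -> L)) pE size_minPoly ltnS lt0n.
move=> q q1 qp; rewrite -(eqp_map (vsval : subvs_of K -> L)) pE.
have := minPoly_irr (p := map_poly vsval q) (K := K) (x := x).
rewrite -pE dvdp_map pE => /(_ _ qp)/orP[] //.
  by apply/polyOverP => i; rewrite coef_map subvsP.
by rewrite -size_poly_eq1 size_map_poly (negPf q1).
Qed.

Section SepticRoots.

Variables (L : splittingFieldType rat) (t : int) (y s : L).
Hypothesis irr_cubic : irreducible_poly (map_poly (intr : int -> rat) (cubic t)).
Hypothesis irr_septic : irreducible_poly (map_poly (intr : int -> rat) (septic t)).
Hypothesis y_root : root (map_poly (intr : int -> L) (cubic t)) y.
Hypothesis ssE : s ^+ 2 = (- 7 * (t - 2) ^+ 2 - 28)%:~R.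

Let K : {subfield L} := <<<<1; s>>; y>>%AS.

(** The two steps of the tower K have degrees at most 2 and 3; being positive and below 7, these are
    prime to 7, so no factor of 7 is lost over K. *)
Lemma adjoin_degree_septic (x : L) :
  root (map_poly (intr : int -> L) (septic t)) x -> adjoin_degree K x = 7%N.
Proof.
move=> px; have d7 : adjoin_degree 1 x = 7%N.
  apply: succn_inj; rewrite (adjoin_degree1_irreducible irr_septic) ?size_map_septic //.
  by rewrite map_poly_intr_alg.
apply/eqP; rewrite eqn_leq -ltnS.
have -> : (adjoin_degree K x < 8)%N.
  rewrite -(size_map_septic L t); apply: adjoin_degree_leq px => //.
    exact: intr_polyOver.
  by rewrite monic_neq0 ?monic_map_septic.
rewrite /= dvdn_leq // -d7; apply: coprime_adjoin_degree_dvdn; rewrite d7.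
rewrite dim_Fadjoin dim_Fadjoin dimv1 muln1 coprimeMr.
apply/andP; split; rewrite prime_coprime // gtnNdvd ?lt0n //.
  apply: (@leq_ltn_trans 3%N) => //; rewrite -ltnS -(size_map_cubic L t).
  apply: adjoin_degree_leq y_root; first exact: intr_polyOver.
  by rewrite -size_poly_gt0 size_map_cubic.
have szq : size ('X^2 - (s ^+ 2)%:P : {poly L}) = 3%N by rewrite size_XnsubC.
apply: (@leq_ltn_trans 2%N) => //; rewrite -ltnS -szq.
apply: adjoin_degree_leq; rewrite -?size_poly_gt0 ?szq //.
  by rewrite rpredB ?polyOverXn // polyOverC ssE rpred_int.
by rewrite /root hornerD hornerN hornerXn hornerC subrr.
Qed.

Lemma septic_cyclic (E : {subfield L}) (x : L) :
  splittingFieldFor K (map_poly (intr : int -> L) (septic t)) E ->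
  root (map_poly (intr : int -> L) (septic t)) x ->
  cyclic_extension K E /\ <<K; x>>%VS = E.
Proof.
move=> splitE px.
have dx := adjoin_degree_septic px.
have t2 : 2 - t%:~R != 0 :> L := cubic_neq2 L irr_cubic.
have Ks : s \in K by apply: subvP_adjoin; exact: memv_adjoin.
have Ky : y \in K by exact: memv_adjoin.
pose z : L := (y ^+ 2 + y - (2 * t%:~R ^+ 2 - 5 * t%:~R + 14)) / (2 - t%:~R).
have zE : (2 - t%:~R) * z = y ^+ 2 + y - (2 * t%:~R ^+ 2 - 5 * t%:~R + 14).
  by rewrite mulrC divfK.
have Kz : z \in K.
  by rewrite !(rpredM, rpredV, rpredD, rpredX, rpredN, rpred_int, rpred1) // rpred_nat.
pose F : fieldType := subvs_of K.
pose vs : {rmorphism F -> L} := vsval.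
pose toF u (Ku : u \in K) : F := Subvs Ku.
have vsE u (Ku : u \in K) : vs (toF u Ku) = u by [].
have n98 : 98 != 0 :> F.
  by rewrite -(fmorph_eq0 vs) (rmorph_nat vs) (intr_fieldExt_eq0 L 98).
have [] := @septic_mult_matrices F t (toF y Ky) (toF z Kz) (toF s Ks) _ _ _ _ n98.
- apply: (fmorph_inj vs); rewrite !(rmorph_nat, rmorph_int, rmorphXn, rmorphN, rmorphM, rmorphD) !vsE.
  exact: cubic_yyE.
- apply: (fmorph_inj vs).
  rewrite !(rmorph_nat, rmorph_int, rmorphXn, rmorph1, rmorphN, rmorphM, rmorphD) !vsE.
  exact: cubic_yzE.
- apply: (fmorph_inj vs).
  rewrite !(rmorph_nat, rmorph_int, rmorphXn, rmorph1, rmorphN, rmorphM, rmorphD) !vsE.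
  exact: cubic_zzE.
- apply: (fmorph_inj vs).
  rewrite !(rmorph_nat, rmorph_int, rmorphXn, rmorph1, rmorphN, rmorphM, rmorphD) !vsE.
  by rewrite -expr2 ssE; ring.
move=> M [cM pM uM].
pose pF := map_poly (intr : int -> F) (septic t).
have pFE : map_poly vs pF = map_poly (intr : int -> L) (septic t).
  by rewrite -map_poly_comp; apply: eq_map_poly => a; exact: (rmorph_int vs).
have pmin : map_poly vs pF = minPoly K x.
  apply/esym/eqP; rewrite -eqp_monic ?monic_minPoly // pFE ?monic_map_septic //.
  rewrite -dvdp_size_eqp ?size_minPoly ?dx ?size_map_septic //.
  by apply: minPoly_dvdp px; exact: intr_polyOver.
have irr_pF : irreducible_poly pF := irreducible_minPoly pmin.
have nz_u : const_mx 1 != 0 :> 'rV[F]_7.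
  by apply/eqP => /rowP/(_ ord0)/eqP; rewrite !mxE oner_eq0.
have /fin_all_exists[r rP] k :=
  mx_poly_root irr_pF (size_map_septic F t) nz_u (cM k) (pM ord0) (pM k).
pose r_ k := (map_poly vs (r k)).[x].
have inj_r : injective r_.
  (* Both polynomials have degree below 7, the degree of [x], so equal values at [x] make them
     equal. The rows [const_mx 1 *m M k] and [const_mx 1 *m M l] then coincide, and for distinct
     indices their entry at [k] would read 6 = -1. *)
  move=> k l klE; have : r k = r l.
    apply/eqP; rewrite -subr_eq0 -(map_poly_eq0 vs); apply/eqP.
    apply/eqP; apply: contraTT isT => nz.
    have : minPoly K x %| map_poly vs (r k - r l).
      apply: minPoly_dvdp; first by apply/polyOverP => i; rewrite coef_map subvsP.
      by rewrite /root rmorphB hornerD hornerN -/(r_ k) klE subrr.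
    rewrite gtNdvdp // size_minPoly dx size_map_poly ltnS.
    rewrite (leq_trans (size_polyD _ _)) // geq_max size_polyN.
    by have [-> _ _] := rP k; have [-> _ _] := rP l.
  have [_ rk _] := rP k; have [_ rl _] := rP l => rkl.
  move: rk; rewrite rkl -rl !uM => /rowP/(_ k); rewrite !mxE eqxx.
  case: eqP => // _ /eqP.
  by rewrite -subr_eq0 opprK -(fmorph_eq0 vs) -(natrD _ 6 1) (rmorph_nat vs) (intr_fieldExt_eq0 L 7).
have p_r k : root (map_poly (intr : int -> L) (septic t)) (r_ k).
  have [_ _ /dvdpP[q qE]] := rP k.
  have px0 : (map_poly vs pF).[x] = 0 by apply/eqP; rewrite pFE.
  rewrite -pFE /root /r_ -horner_comp -map_comp_poly qE.
  by rewrite (rmorphM (map_poly vs)) hornerM px0 mulr0.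
have [|||||sep defE] := @splittingField_generating_root _ L K E _ x
  [seq r_ k | k <- enum 'I_7] (monic_map_septic L t) splitE.
- by rewrite map_inj_uniq ?enum_uniq.
- by rewrite size_map size_enum_ord size_map_septic.
- by apply/allP => _ /mapP[k _ ->]; exact: p_r.
- exact: px.
- move=> _ /mapP[k _ ->]; apply: rpred_horner; last exact: memv_adjoin.
  apply/polyOverP => i; rewrite coef_map; apply: subvP_adjoin; exact: subvsP.
split=> //; apply: (cyclic_of_generating_root (intr_polyOver K _) sep splitE defE).
by rewrite dx.
Qed.

End SepticRoots.

(** * Prime ideals of rings of integers *)

(** A rational linear relation is stored as a polynomial so that [zprimitive] can divide out its
    content; content 1 leaves a coefficient prime to [q]. *)
Lemma int_relation (L : fieldExtType rat) (E : {subfield L}) (b : seq L) (q : nat) :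
  prime q -> {subset b <= E} -> (\dim E < size b)%N ->
  exists f : {poly int}, [/\ (size f <= size b)%N, f \isn't a polyOver (dvdz q) &
    \sum_(i < size b) (f`_i)%:~R * b`_i = 0].
Proof.
move=> pr_q bE ltEb; apply: NNPP => norel.
suff : free (in_tuple b).
  move=> /eqP fb; have : (\dim <<in_tuple b>> <= \dim E)%N.
    by apply: dimvS; apply/span_subvP.
  by rewrite fb leqNgt ltEb.
apply/freeP => k sum_k i; apply/eqP; case: eqP => // /eqP nz_ki.
case: norel; pose g := \poly_(j < size b) (if insub j is Some o then k o else 0).
have gE (j : 'I_(size b)) : g`_j = k j.
  by rewrite coef_poly ltn_ord insubT // => lt_j; congr k; exact: val_inj.
have nz_g : g != 0.
  by apply: contra_neq nz_ki => g0; rewrite -gE g0 coef0.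
have [f [a nz_a gf]] := rat_poly_scale g.
have nz_f : f != 0.
  by apply: contra_neq nz_g => f0; rewrite gf f0 rmorph0 scaler0.
exists (zprimitive f); split.
- have := size_poly (size b) (fun j => if insub j is Some o then k o else 0).
  rewrite -/g gf size_scale ?invr_eq0 ?intr_eq0 // size_map_inj_poly //.
  + by rewrite size_zprimitive.
  + exact: intr_inj.
- rewrite -dvdz_contents zcontents_primitive nz_f dvdzE /= dvdn1.
  by rewrite gtn_eqF ?prime_gt1.
- have nz_c : (zcontents f)%:~R != 0 :> L by rewrite intr_fieldExt_eq0 zcontents_eq0.
apply: (mulfI nz_c); rewrite mulr0 mulr_sumr.
have nz_aL : (a%:~R : rat)^-1 != 0 by rewrite invr_eq0 intr_eq0.
apply: (scalerI nz_aL); rewrite scaler0 scaler_sumr -[RHS]sum_k.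
apply: eq_bigr => j _; rewrite -gE gf coefZ coef_map /= mulrA -intrM.
rewrite -coefZ -zpolyEprim -scalerA; congr (_ *: _).
by rewrite -(rmorph_int (in_alg L)) /= mulr_algl.
Qed.

Section PrimeIdeal.

Variables (L : splittingFieldType rat) (E : {subfield L}) (P : L -> Prop).
Let O := ring_of_integers E.

Lemma integers_int (a : int) : O a%:~R.
Proof. by split; [exact: rpred_int | exact: (integral_id intr)]. Qed.

Lemma integers_nat (n : nat) : O n%:R.
Proof. exact: (integers_int n). Qed.

Lemma integers0 : O 0. Proof. exact: (integers_nat 0). Qed.
Lemma integers1 : O 1. Proof. exact: (integers_nat 1). Qed.

Lemma integersD x y : O x -> O y -> O (x + y).
Proof. by case=> Ex ix [Ey iy]; split; [exact: rpredD | exact: integral_add]. Qed.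

Lemma integersN x : O x -> O (- x).
Proof. by case=> Ex ix; split; [rewrite rpredN | exact: integral_opp]. Qed.

Lemma integersB x y : O x -> O y -> O (x - y).
Proof. by move=> Ox /integersN; exact: integersD. Qed.

Lemma integersM x y : O x -> O y -> O (x * y).
Proof. by case=> Ex ix [Ey iy]; split; [exact: rpredM | exact: integral_mul]. Qed.

Lemma integersX x n : O x -> O (x ^+ n).
Proof.
move=> Ox; elim: n => [|n IH]; first exact: integers1.
by rewrite exprS; exact: integersM.
Qed.

Lemma integers_sum (I : Type) (r : seq I) (Q : pred I) (F : I -> L) :
  (forall i, Q i -> O (F i)) -> O (\sum_(i <- r | Q i) F i).
Proof. by move=> OF; apply: big_ind => //; [exact: integers0 | exact: integersD]. Qed.

Lemma integers_prod (I : Type) (r : seq I) (Q : pred I) (F : I -> L) :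
  (forall i, Q i -> O (F i)) -> O (\prod_(i <- r | Q i) F i).
Proof. by move=> OF; apply: big_ind => //; [exact: integers1 | exact: integersM]. Qed.

Lemma integers_gal x (g : gal_of E) : O x -> O (g x).
Proof.
case=> Ex ix; split; first exact: memv_gal.
case: ix => f mon_f fx; exists f => //.
have -> : map_poly intr f = map_poly g (map_poly intr f).
  by rewrite -map_poly_comp; apply: eq_map_poly => a /=; rewrite rmorph_int.
exact: rmorph_root.
Qed.

Lemma integers_horner (f : {poly int}) x : O x -> O (map_poly intr f).[x].
Proof.
move=> Ox; rewrite horner_poly; apply: integers_sum => i _.
by apply: integersM; [exact: integers_int | exact: integersX].
Qed.

End PrimeIdeal.

Section Ideals.

Variables (L : splittingFieldType rat) (E : {subfield L}) (I : L -> Prop).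
Let O := ring_of_integers E.
Hypothesis idI : is_ideal O I.

Lemma ideal_integral x : I x -> O x. Proof. by case: idI => h _ _ _; exact: h. Qed.
Lemma ideal0 : I 0. Proof. by case: idI. Qed.
Lemma idealD x y : I x -> I y -> I (x + y). Proof. by case: idI => _ _ h _; exact: h. Qed.
Lemma ideal_mull a x : O a -> I x -> I (a * x). Proof. by case: idI => _ _ _ h; exact: h. Qed.
Lemma ideal_mulr a x : O a -> I x -> I (x * a). Proof. by rewrite mulrC; exact: ideal_mull. Qed.

Lemma idealN x : I x -> I (- x).
Proof. by move=> Ix; rewrite -mulN1r; apply: ideal_mull Ix; exact: (integers_int E (-1)). Qed.

Lemma idealB x y : I x -> I y -> I (x - y).
Proof. by move=> Ix /idealN; exact: idealD. Qed.

Lemma ideal_sum (J : Type) (r : seq J) (Q : pred J) (F : J -> L) :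
  (forall i, Q i -> I (F i)) -> I (\sum_(i <- r | Q i) F i).
Proof. by move=> IF; apply: big_ind => //; [exact: ideal0 | exact: idealD]. Qed.

Lemma ideal_congM x y x' y' : O x -> O y' -> I (x - x') -> I (y - y') ->
  I (x * y - x' * y').
Proof.
move=> Ox Oy' Ix Iy; have -> : x * y - x' * y' = x * (y - y') + (x - x') * y' by ring.
by apply: idealD; [exact: ideal_mull | exact: ideal_mulr].
Qed.

Lemma ideal_cong_det n (A B : 'M[L]_n) : (forall i j, O (A i j)) ->
  (forall i j, O (B i j)) -> (forall i j, I (A i j - B i j)) -> I (\det A - \det B).
Proof.
move=> OA OB AB.
pose R x y := [/\ O x, O y & I (x - y)].
suff [] : R (\det A) (\det B) by [].
apply: big_ind2 => [|x x' y y' [Ox Ox' Ix] [Oy Oy' Iy]|sg _].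
- by rewrite /R subrr; split; [exact: integers0..|exact: ideal0].
- split; [exact: integersD..|].
  by rewrite opprD addrACA; exact: idealD.
have Osg : O ((-1) ^+ sg) by apply: integersX; exact: (integers_int E (-1)).
suff [Oa Ob Iab] : R (\prod_i A i (sg i)) (\prod_i B i (sg i)).
  by split; [exact: integersM..|rewrite -mulrBr; exact: ideal_mull].
apply: big_ind2 => [|x x' y y' [Ox Ox' Ix] [Oy Oy' Iy]|i _] //.
- by rewrite /R subrr; split; [exact: integers1..|exact: ideal0].
- by split; [exact: integersM..|exact: ideal_congM].
Qed.

End Ideals.

Section PrimeIdeals.

Variables (L : splittingFieldType rat) (E : {subfield L}) (P : L -> Prop).
Let O := ring_of_integers E.
Hypothesis prP : nonzero_prime_ideal O P.

Let idP : is_ideal O P. Proof. by case: prP. Qed.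

Lemma prime_ideal_proper : ~ P 1. Proof. by case: prP. Qed.

Lemma prime_idealM x y : O x -> O y -> P (x * y) -> P x \/ P y.
Proof. by case: prP => _ _ h _; exact: h. Qed.

Lemma prime_idealX x n : O x -> P (x ^+ n) -> P x.
Proof.
move=> Ox; elim: n => [/prime_ideal_proper//|n IH].
by rewrite exprS => /prime_idealM[] //; exact: integersX.
Qed.

Lemma prime_ideal_prod (J : Type) (r : seq J) (Q : pred J) (F : J -> L) :
  (forall i, Q i -> O (F i)) -> (forall i, Q i -> ~ P (F i)) ->
  ~ P (\prod_(i <- r | Q i) F i).
Proof.
move=> OF nP; suff [] : O (\prod_(i <- r | Q i) F i) /\ ~ P (\prod_(i <- r | Q i) F i) by [].
apply: (big_ind (fun x => O x /\ ~ P x)).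
- by split; [exact: integers1 | exact: prime_ideal_proper].
- move=> x y [Ox nx] [Oy ny]; split; first exact: integersM.
  by case/prime_idealM.
- by move=> i Qi; split; [exact: OF | exact: nP].
Qed.

(** A nonzero element of P is a root of an integer polynomial; after removing factors X the constant
    term is a nonzero integer in P, and primality of P selects one of its prime factors. *)
Lemma prime_ideal_prime : exists2 q : nat, prime q & P q%:R.
Proof.
have [x Px nz_x] : exists2 x, P x & x != 0 by case: prP.
have [n n_gt0 Pn] : exists2 n : nat, (0 < n)%N & P n%:R.
  have [_ [f mon_f fx]] := ideal_integral idP Px.
  have : f != 0 by exact: monic_neq0.
  elim/poly_ind: f {mon_f} fx => [|f c IH] ; first by rewrite eqxx.
  rewrite /root rmorphD rmorphM /= map_polyX map_polyC /= hornerMXaddC => fx nz_f.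
  have [c0|nz_c] := eqVneq c 0.
    move: fx nz_f; rewrite c0 rmorph0 !addr0 mulf_eq0 (negPf nz_x) orbF => fx nz_f.
    by apply: IH => //; apply: contra_neq nz_f => ->; rewrite mul0r.
  have Pc : P c%:~R.
    have -> : c%:~R = - ((map_poly intr f).[x] * x).
      by apply/eqP; rewrite -addr_eq0 addrC; exact: fx.
    apply: (idealN idP); apply: (ideal_mull idP) => //.
    apply: integers_horner; exact: (ideal_integral idP).
  exists `|c|%N; first by rewrite absz_gt0.
  case: (c) Pc => // m Pm; rewrite -[_%:R]opprK; exact: (idealN idP).
have [m] := ubnP n; elim: m n n_gt0 Pn => // m IH n n_gt0 Pn le_nm.
have [n1|n_gt1] := leqP n 1.
  by case: prime_ideal_proper; move: Pn; have -> : n = 1%N by lia.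
have [p pr dv] : exists2 p, prime p & (p %| n)%N.
  by exists (pdiv n); [exact: pdiv_prime | exact: pdiv_dvd].
have := prime_idealM (x := (n %/ p)%:R) (y := p%:R).
rewrite -natrM divnK // => /(_ (integers_nat E _) (integers_nat E _) Pn)[h|h].
  have d_gt0 : (0 < n %/ p)%N by rewrite divn_gt0 ?prime_gt0 // dvdn_leq.
  have lt_d : (n %/ p < m)%N.
    by rewrite ltnS in le_nm; apply: leq_trans le_nm; rewrite ltn_Pdiv ?prime_gt1.
  exact: IH d_gt0 h lt_d.
by exists p.
Qed.

(** [a] satisfies an integer relation that is nonzero modulo q. As long as the constant term is
    divisible by q, a factor [a] can be cancelled modulo P; once it is prime to q, the relation
    exhibits an inverse of [a] modulo P. *)
Lemma prime_ideal_maximal a : O a -> ~ P a -> exists2 e, O e & P (1 - e * a).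
Proof.
move=> Oa nPa; have [q pr_q Pq] := prime_ideal_prime.
have [f nq_f f0] : exists2 f : {poly int}, f \isn't a polyOver (dvdz q) &
    (map_poly intr f).[a] = 0.
  pose b := mkseq (fun i => a ^+ i) (\dim E).+1.
  have bE : {subset b <= E}.
    by move=> _ /mapP[i _ ->]; apply: rpredX; case: Oa.
  have ltEb : (\dim E < size b)%N by rewrite size_mkseq.
  have [f [szf nq_f f0]] := int_relation pr_q bE ltEb.
  exists f => //; rewrite (@horner_coef_wide _ (size b)) ?(leq_trans (size_poly _ _)) //.
  rewrite -[RHS]f0; apply: eq_bigr => i _.
  by have := ltn_ord i; rewrite [X in (_ < X)%N]size_mkseq coef_map => lti; rewrite nth_mkseq.
have : P (map_poly intr f).[a] by rewrite f0; exact: (ideal0 idP).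
elim/poly_ind: f nq_f {f0} => [|f c IH]; first by rewrite rpred0.
rewrite rmorphD rmorphM /= map_polyX map_polyC /= hornerMXaddC => nq_f Pf.
have Of : O (map_poly intr f).[a] by exact: integers_horner.
have [/dvdzP[d cE]|nqc] := boolP (q%:Z %| c)%Z.
  apply: IH.
    apply: contra nq_f => /polyOverP qf; apply/polyOverP => -[|i].
      by rewrite coefD coefMX coefC add0r; apply/dvdzP; exists d.
    by rewrite coefD coefMX coefC addr0.
  have : P ((map_poly intr f).[a] * a).
    rewrite -[_ * a](addrK c%:~R); apply: (idealB idP) => //.
    rewrite cE intrM; apply: (ideal_mull idP) => //; exact: integers_int.
  by case/prime_idealM.
have [u [v uv]] : exists u v, u * c + v * q%:Z = 1.
  have /coprimezP[[u v] uv] : coprimez c q.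
    by rewrite coprimez_sym coprimezE prime_coprime.
  by exists u, v.
exists (- (u%:~R * (map_poly intr f).[a])).
  by apply: integersN; apply: integersM => //; exact: integers_int.
have -> : 1 - - (u%:~R * (map_poly intr f).[a]) * a =
    u%:~R * ((map_poly intr f).[a] * a + c%:~R) + v%:~R * q%:R.
  have uvL : u%:~R * c%:~R + v%:~R * q%:R = 1 :> L.
    by rewrite -[q%:R]/(q%:Z%:~R) -!intrM -intrD uv.
  by rewrite -{1}uvL; ring.
by apply: (idealD idP); apply: (ideal_mull idP) => //; exact: integers_int.
Qed.

End PrimeIdeals.

(** * Finite generation and Nakayama's argument *)

Section PrimeIdealFinite.

Variables (L : splittingFieldType rat) (E : {subfield L}) (P : L -> Prop).
Let O := ring_of_integers E.
Hypothesis prP : nonzero_prime_ideal O P.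

Let idP : is_ideal O P. Proof. by case: prP. Qed.

(** No integral basis is built. A maximal family in P independent modulo q O over Z/q has at most
    [\dim E] members by [int_relation]; together with q it generates P, since by maximality any
    further element of P enters a relation with a coefficient invertible modulo q. *)
Lemma prime_ideal_generators : exists g : seq L,
  [/\ {in g, forall x, P x}, exists2 u, u \in g & u != 0
    & forall x, P x -> exists2 c : 'I_(size g) -> L,
        forall i, O (c i) & x = \sum_(i < size g) c i * g`_i].
Proof.
have [q pr_q Pq] := prime_ideal_prime prP.
pose indep (b : seq L) := forall c : nat -> int,
  (exists2 w, O w & \sum_(i < size b) (c i)%:~R * b`_i = q%:R * w) ->
  forall i, (i < size b)%N -> (q %| c i)%Z.
suff H k b : (size b + k = (\dim E).+1)%N -> {in b, forall x, P x} -> indep b ->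
    exists g : seq L, [/\ {in g, forall x, P x}, exists2 u, u \in g & u != 0
    & forall x, P x -> exists2 c : 'I_(size g) -> L,
        forall i, O (c i) & x = \sum_(i < size g) c i * g`_i].
  by apply: (H (\dim E).+1 [::]).
elim: k b => [|k IH] b szb Pb indb.
  have bE : {subset b <= E} by move=> x /Pb /(ideal_integral idP)[].
  have ltEb : (\dim E < size b)%N by rewrite -szb addn0.
  have [f [szf nq_f f0]] := int_relation pr_q bE ltEb.
  case/negP: nq_f.
  apply/polyOverP => i; have [ltib|lebi] := ltnP i (size b).
    apply: (indb (fun i => f`_i)) ltib; exists 0; first exact: integers0.
    by rewrite mulr0.
  by rewrite nth_default ?dvdz0 // (leq_trans szf).
have [[x [Px indx]]|max_b] := classic (exists x, P x /\ indep (x :: b)).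
  apply: IH indx; first by rewrite /= addSnnS.
  by move=> y; rewrite inE => /orP[/eqP->|/Pb].
exists (q%:R :: b); split.
- by move=> y; rewrite inE => /orP[/eqP->|/Pb].
- exists q%:R; first exact: mem_head.
  by rewrite (intr_fieldExt_eq0 L q) -lt0n prime_gt0.
move=> x Px.
have [c] : exists c : nat -> int, ~ ((exists2 w, O w &
  \sum_(i < size (x :: b)) (c i)%:~R * (x :: b)`_i = q%:R * w) ->
  forall i, (i < size (x :: b))%N -> (q %| c i)%Z).
  by apply: not_all_ex_not => h; apply: max_b; exists x.
move=> h; have [[w Ow rel] ndiv] := imply_to_and _ _ h.
move: rel; rewrite big_ord_recl /= => rel.
have [/dvdzP[d c0]|nq0] := boolP (q %| c 0%N)%Z.
  case: ndiv => -[|i] //; first by rewrite c0 dvdz_mull.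
  rewrite ltnS; apply: (indb (fun i => c i.+1)).
  exists (w - d%:~R * x).
    apply: integersB => //; apply: integersM; first exact: integers_int.
    exact: (ideal_integral idP).
  have -> : \sum_(i < size b) (c i.+1)%:~R * b`_i = q%:R * w - (c 0%N)%:~R * x.
    by rewrite -rel addrAC subrr add0r.
  by rewrite c0 intrM; ring.
have [[u v] uv] : exists uv : int * int, uv.1 * c 0%N + uv.2 * q%:Z = 1.
  by apply/coprimezP; rewrite coprimez_sym coprimezE prime_coprime.
(* Write x = u (c_0 x) + v q x, where c_0 x is q w minus the combination of the [b] family. Index 0
   is the generator q and collects u w + v x. *)
exists (fun i => if i == 0%N :> nat then u%:~R * w + v%:~R * x
   else (- u * c i)%:~R).
  move=> i; case: ifP => _; last exact: integers_int.
  apply: integersD; apply: integersM; try exact: integers_int; first by [].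
  exact: (ideal_integral idP).
rewrite big_ord_recl /=.
under eq_bigr => i _ do rewrite intrM -mulrA.
rewrite -mulr_sumr.
have -> : \sum_(i < size b) (c (lift ord0 i))%:~R * b`_i
    = q%:R * w - (c 0%N)%:~R * x.
  by rewrite -rel addrAC subrr add0r.
have uvL : u%:~R * (c 0%N)%:~R + v%:~R * q%:R = 1 :> L.
  by rewrite -[q%:R]/(q%:Z%:~R) -!intrM -intrD uv.
by rewrite -[LHS]mul1r -[X in X * _ = _]uvL; ring.
Qed.

(** Determinant trick: if P = P^2, the generators satisfy g = A g with entries of A in P. Then det
    (1 - A) annihilates every generator, yet it is congruent to 1 modulo P and hence nonzero. [Q]
    leaves room for the nested products of [ideal_exp]. *)
Lemma prime_ideal_not_idempotent (Q : L -> Prop) :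
  (forall x, Q x -> exists n (a b : 'I_n -> L),
    [/\ forall i, P (a i), forall i, P (b i) & x = \sum_(i < n) a i * b i]) ->
  ~ (forall x, P x -> Q x).
Proof.
move=> QPP PQ; have [g [Pg [u ug nz_u] gen]] := prime_ideal_generators.
have /fin_all_exists[A AP] (i : 'I_(size g)) : exists F : 'I_(size g) -> L,
    (forall j, P (F j)) /\ g`_i = \sum_j F j * g`_j.
  have [n [a [b [Pa Pb gE]]]] := QPP _ (PQ _ (Pg _ (mem_nth 0 (ltn_ord i)))).
  have /fin_all_exists[c cP] (k : 'I_n) : exists F : 'I_(size g) -> L,
      (forall j, O (F j)) /\ b k = \sum_j F j * g`_j.
    by have [F OF bE] := gen _ (Pb k); exists F.
  exists (fun j => \sum_k a k * c k j); split=> [j|].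
    apply: (ideal_sum idP) => k _. apply: (ideal_mulr idP); last exact: Pa.
    exact: (cP k).1.
  rewrite gE; under eq_bigr => k _ do rewrite (cP k).2 mulr_sumr.
  rewrite exchange_big; apply: eq_bigr => j _; rewrite mulr_suml.
  by apply: eq_bigr => k _; rewrite mulrA.
pose M := \matrix_(i, j) ((i == j)%:R - A i j).
pose v := \col_(i < size g) g`_i.
have Mv : M *m v = 0.
  apply/colP => i; rewrite !mxE; under eq_bigr => j _ do rewrite !mxE mulrBl.
  rewrite sumrB -(AP i).2 (bigD1 i) //= eqxx mul1r big1 ?addr0 ?subrr // => j.
  by rewrite eq_sym => /negPf->; rewrite mul0r.
have detM : \det M != 0.
  apply/eqP => det0; have OA i j : O (A i j) by apply: (ideal_integral idP); exact: (AP i).1.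
  have Od (i j : 'I_(size g)) : O (1%:M i j).
    by rewrite mxE; exact: integers_nat.
  have OM i j : O (M i j) by rewrite mxE; apply: integersB; [exact: integers_nat | exact: OA].
  have := ideal_cong_det idP Od OM; rewrite det1 det0 subr0 => P1.
  apply: (prime_ideal_proper prP); apply: P1 => i j.
  by rewrite !mxE opprB addrC subrK; exact: (AP i).1.
have : v = 0.
  apply: (scalerI detM); rewrite scaler0 -mul_scalar_mx -mul_adj_mx -mulmxA Mv.
  by rewrite mulmx0.
move/colP => v0; case/eqP: nz_u.
have ltu : (index u g < size g)%N by rewrite index_mem.
by have := v0 (Ordinal ltu); rewrite !mxE /= nth_index.
Qed.

End PrimeIdealFinite.

Lemma ideal_mul_ideal (L : splittingFieldType rat) (E : {subfield L})
  (I J : L -> Prop) (O := ring_of_integers E) :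
  is_ideal O I -> is_ideal O J -> is_ideal O (ideal_mul I J).
Proof.
move=> idI idJ; split.
- move=> x [n [a [b [Ia Jb ->]]]]; apply: integers_sum => i _.
  by apply: integersM; [exact: (ideal_integral idI) | exact: (ideal_integral idJ)].
- by exists 0%N, (fun=> 0), (fun=> 0); split=> [[]|[]|] //; rewrite big_ord0.
- move=> x y [n [a [b [Ia Jb ->]]]] [m [a' [b' [Ia' Jb' ->]]]].
  exists (n + m)%N, (fun i => match split i with inl j => a j | inr k => a' k end),
    (fun i => match split i with inl j => b j | inr k => b' k end).
  split=> [i|i|]; try by case: split.
  rewrite big_split_ord; congr (_ + _); apply: eq_bigr => i _.
    by rewrite (unsplitK (inl i)).
  by rewrite (unsplitK (inr i)).
- move=> c x Oc [n [a [b [Ia Jb ->]]]]; exists n, (fun i => c * a i), b; split=> //.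
    by move=> i; exact: (ideal_mull idI).
  by rewrite mulr_sumr; apply: eq_bigr => i _; rewrite mulrA.
Qed.

Lemma integers_ideal (L : splittingFieldType rat) (E : {subfield L}) :
  is_ideal (ring_of_integers E) (ring_of_integers E).
Proof.
split=> //; [exact: integers0 | exact: integersD | exact: integersM].
Qed.

(** * Inertia and the ramification index *)

Section Unramified.

Variables (L : splittingFieldType rat) (K E : {subfield L}) (P : L -> Prop).
Let O := ring_of_integers E.
Hypothesis galKE : galois K E.
Hypothesis prP : nonzero_prime_ideal O P.

Let idP : is_ideal O P. Proof. by case: prP. Qed.

(* Eliminating one automorphism at a time, as in the proof of Dedekind's
   independence of characters. *)
Lemma dedekind_elimination (Q : L -> Prop) (s : seq (gal_of E)) (g : gal_of E -> L) :
  is_ideal O Q -> {in s, forall h : gal_of E, exists2 a, O a & ~ P (h a - a)} ->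
  (forall h, O (g h)) ->
  (forall b, O b -> Q (g 1%g * b + \sum_(h <- s) g h * h b)) ->
  exists d, [/\ O d, ~ P d & Q (d * g 1%g)].
Proof.
move=> idQ; elim: s g => [|h s IH] g hs Og Qg.
  exists 1; split; [exact: integers1 | exact: (prime_ideal_proper prP) |].
  have := Qg 1 (integers1 E); by rewrite big_nil addr0 mulrC.
have [a Oa nPa] := hs h (mem_head _ _).
have Oha : O (h a) by exact: integers_gal.
have [||b Ob|d [Od nPd Qd]] := IH (fun k => g k * (k a - h a)).
- by move=> k ks; apply: hs; rewrite inE ks orbT.
- by move=> k; apply: integersM; [exact: Og | apply: integersB; exact: integers_gal].
- rewrite gal_id.
  have -> : g 1%g * (a - h a) * b + \sum_(k <- s) g k * (k a - h a) * k b =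
      (g 1%g * (a * b) + \sum_(k <- h :: s) g k * k (a * b))
      - h a * (g 1%g * b + \sum_(k <- h :: s) g k * k b).
    have -> : \sum_(k <- s) g k * (k a - h a) * k b =
        \sum_(k <- s) g k * k (a * b) - h a * \sum_(k <- s) g k * k b.
      rewrite mulr_sumr -sumrB; apply: eq_bigr => k _.
      by rewrite rmorphM /=; ring.
    by rewrite !big_cons rmorphM /=; ring.
  by apply: (idealB idQ); [|apply: (ideal_mull idQ) => //]; apply: Qg => //; exact: integersM.
rewrite gal_id in Qd.
exists (d * (a - h a)); split.
- by apply: integersM => //; exact: integersB.
- case/(prime_idealM prP) => //; first exact: integersB.
  by move/(idealN idP); rewrite opprB.
- by have -> : d * (a - h a) * g 1%g = d * (g 1%g * (a - h a)) by ring.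
Qed.

(** Replaces the Chinese remainder theorem. If h does not map P into P, some c outside P has h c in
    P: otherwise the inverse of h would preserve P, and so would h, one of its powers as the group
    is finite. *)
Lemma prime_ideal_gal_multiplier (h : gal_of E) :
  exists c, [/\ O c, ~ P c & forall x, P x -> P (h (c * x))].
Proof.
have [hP|] := classic (forall x, P x -> P (h x)).
  exists 1; split; [exact: integers1 | exact: (prime_ideal_proper prP) |].
  by move=> x /hP; rewrite mul1r.
move=> nhP; have [x0 [Px0 nPx0]] : exists x, P x /\ ~ P (h x).
  by have [x nx] := not_all_ex_not _ _ nhP; exists x; exact: imply_to_and.
have [c [Oc nPc Phc]] : exists c, [/\ O c, ~ P c & P (h c)].
  apply: NNPP => none; apply: nPx0.
  have Pinv x : P x -> P (h^-1%g x).
    move=> Px; have [Ex ix] := ideal_integral idP Px.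
    apply: NNPP => nP; apply: none; exists (h^-1%g x); split=> //.
      by apply: integers_gal; split.
    by rewrite -galM // mulVg gal_id.
  have Pinvn n x : P x -> P ((h^-1 ^+ n)%g x).
    elim: n x => [|n IH] x Px; first by rewrite expg0 gal_id.
    rewrite expgS galM; first by apply: IH; exact: Pinv.
    by have [] := ideal_integral idP Px.
  have -> : h = ((h^-1) ^+ (#[h].-1))%g.
    by rewrite expgVn -invg_expg invgK.
  exact: Pinvn.
exists c; split=> // x Px; rewrite rmorphM; apply: (ideal_mulr idP) => //.
by apply: integers_gal; exact: (ideal_integral idP).
Qed.

(** A common multiplier C outside P puts all conjugates of C x into P. The traces of C x b therefore
    lie in P and in K, hence in Q, and eliminating the nontrivial automorphisms leaves d C x in Q
    with d outside P. Inverting d C modulo P writes x as an element of P P plus one of Q. *)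
Lemma prime_ideal_sub_trace (Q : L -> Prop) : is_ideal O Q ->
  (forall h, h \in 'Gal(E / K)%g -> h != 1%g -> exists2 a, O a & ~ P (h a - a)) ->
  (forall x, P x -> x \in K -> Q x) ->
  (forall x y, P x -> P y -> Q (x * y)) -> forall x, P x -> Q x.
Proof.
move=> idQ inertia PKQ PPQ x Px.
have /fin_all_exists[c cP] (h : gal_of E) := prime_ideal_gal_multiplier h.
pose C := \prod_h c h.
have Oc h : O (c h) by have [] := cP h.
have OC : O C by apply: integers_prod => h _; exact: Oc.
have nPC : ~ P C.
  by apply: (prime_ideal_prod prP) => h _; [exact: Oc | have [] := cP h].
have Ox := ideal_integral idP Px.
have PhC (h : gal_of E) : P (h (C * x)).
  rewrite /C (bigD1 h) //= mulrAC rmorphM; apply: (ideal_mulr idP).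
    by apply/integers_gal/integers_prod => k _; exact: Oc.
  by have [_ _] := cP h; exact.
pose s := enum ('Gal(E / K)%g :\ 1%g).
have [||b Ob|d [Od nPd Qd]] := @dedekind_elimination Q s (fun h : gal_of E => h (C * x)) idQ.
- by move=> h; rewrite mem_enum !inE => /andP[h1 hG]; exact: inertia.
- by move=> h; apply: integers_gal; exact: integersM.
- have trE : (1%g : gal_of E) (C * x) * b + \sum_(h <- s) h (C * x) * h b =
      galTrace K E (C * x * b).
    rewrite /galTrace (bigD1 1%g) //= !gal_id big_enum /=; congr (_ + _).
    by apply: eq_big => h; [rewrite !inE andbC | rewrite [in RHS]rmorphM].
  rewrite trE; apply: PKQ.
    apply: (ideal_sum idP) => h _; rewrite rmorphM.
    by apply: (ideal_mulr idP); [exact: integers_gal | exact: PhC].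
  have /galois_fixedField fK := galKE; rewrite -[in X in _ \in X]fK.
  apply: galTrace_fixedField; rewrite !rpredM //; first by case: OC.
    by case: Ox.
  by case: Ob.
rewrite gal_id in Qd.
have nPdC : ~ P (d * C) by case/(prime_idealM prP).
have [e Oe Pe] := prime_ideal_maximal prP (integersM Od OC) nPdC.
have -> : x = (1 - e * (d * C)) * x + e * (d * (C * x)) by ring.
by apply: (idealD idQ); [exact: PPQ | exact: (ideal_mull idQ)].
Qed.

(* In a group of prime order the inertia group is trivial once it is proper. *)
Lemma ramification_index1 (h : gal_of E) (a : L) :
  prime #|'Gal(E / K)%g| -> h \in 'Gal(E / K)%g -> O a -> ~ P (h a - a) ->
  ramification_index K E P 1.
Proof.
move=> prG hG Oa nPa; split.
  move=> x [n [b [c [Pb Oc ->]]]]; exists n, b, c; split=> // i.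
  by have [] := Pb i.
move=> subQ.
have idPO := ideal_mul_ideal idP (integers_ideal E).
(* If the extended ideal lay in P^2, the trace lemma with Q = P^2 would give P inside P^2. *)
apply: (prime_ideal_not_idempotent prP (Q := ideal_exp O P 2)).
  move=> x [n [b [c [Pb PO ->]]]]; exists n, b, c; split=> // i.
  have [m [b' [c' [Pb' Oc' ->]]]] := PO i.
  by apply: (ideal_sum idP) => j _; apply: (ideal_mulr idP); [exact: Oc' | exact: Pb'].
apply: (@prime_ideal_sub_trace (ideal_exp O P 2) (ideal_mul_ideal idP idPO)).
- move=> k kG k1; apply: NNPP => inert.
  have Pk b : O b -> P (k b - b).
    by move=> Ob; apply: NNPP => nP; apply: inert; exists b.
  have Pkn n b : O b -> P ((k ^+ n)%g b - b).
    move=> Ob; elim: n => [|n IH].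
      by rewrite expg0 gal_id subrr; exact: (ideal0 idP).
    rewrite expgSr galM; last by case: Ob.
    have -> : k ((k ^+ n)%g b) - b = (k ((k ^+ n)%g b) - (k ^+ n)%g b)
      + ((k ^+ n)%g b - b) by ring.
    by apply: (idealD idP) => //; apply: Pk; exact: integers_gal.
  apply: nPa; have : h \in <[k]>%g.
    have -> : <[k]>%g = 'Gal(E / K)%g; last by [].
    apply/eqP; rewrite eqEcard cycle_subG kG /=.
    have kG' : <[k]>%g \subset 'Gal(E / K)%g by rewrite cycle_subG.
    have /primeP[_ /(_ _ (cardSg kG'))/orP[/eqP k1'|/eqP->//]] := prG.
    by move: k1; rewrite -cycle_eq1 trivg_card1 k1'.
  by case/cycleP => n ->; exact: Pkn.
- move=> x Px Kx; apply: subQ; exists 1%N, (fun=> x), (fun=> 1); split=> //.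
    by move=> _; exact: integers1.
  by rewrite big_ord1 mulr1.
- move=> x y Px Py; exists 1%N, (fun=> x), (fun=> y); split=> //.
    move=> _; exists 1%N, (fun=> y), (fun=> 1); split=> //.
      by move=> _; exact: integers1.
    by rewrite big_ord1 mulr1.
  by rewrite big_ord1.
Qed.

End Unramified.

(** * Totally ramified primes *)

Lemma coef_prod_XsubC_scale (R : comNzRingType) (w : R) (rs : seq R) i :
  (i <= size rs)%N ->
  (\prod_(r <- rs) ('X - (r * w)%:P))`_i =
  (\prod_(r <- rs) ('X - r%:P))`_i * w ^+ (size rs - i).
Proof.
elim: rs i => [|r rs IH] i; first by rewrite leqn0 => /eqP->; rewrite !big_nil mulr1.
rewrite !big_cons !mulrBl !coefB !coefXM !coefCM /= => le_i.
have eq_i : r * w * (\prod_(r <- rs) ('X - (r * w)%:P))`_i =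
    r * (\prod_(r <- rs) ('X - r%:P))`_i * w ^+ ((size rs).+1 - i).
  have [le_is|lt_si] := leqP i (size rs).
    by rewrite IH // subSn // exprS; ring.
  by rewrite !nth_default ?size_prod_XsubC ?mulr0 ?mul0r // -(big_map (fun r => r * w)
    xpredT (fun r => 'X - r%:P)) size_prod_XsubC size_map.
case: i le_i eq_i => [|i] /=; first by move=> _ ->; rewrite mulrBl mul0r.
by rewrite ltnS subSS => le_i ->; rewrite IH // mulrBl.
Qed.

Section PolyCongruence.

Variables (L : splittingFieldType rat) (E : {subfield L}) (P : L -> Prop).
Let O := ring_of_integers E.
Hypothesis idealP : is_ideal O P.

(** Integrality of both sides is built in, so that the relation is stable under products. *)
Definition poly_cong (p q : {poly L}) : Prop :=
  forall i, [/\ O p`_i, O q`_i & P (p`_i - q`_i)].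

Lemma poly_congM p q p' q' :
  poly_cong p q -> poly_cong p' q' -> poly_cong (p * p') (q * q').
Proof.
move=> pq pq' i; rewrite !coefM -sumrB; split.
- by apply: integers_sum => j _; apply: integersM; [have [] := pq j | have [] := pq' (i - j)%N].
- by apply: integers_sum => j _; apply: integersM; [have [] := pq j | have [] := pq' (i - j)%N].
apply: (ideal_sum idealP) => j _; have [Op Oq Pq] := pq j; have [Op' Oq' Pq'] := pq' (i - j)%N.
exact: (ideal_congM idealP).
Qed.

Lemma poly_cong1 : poly_cong 1 1.
Proof.
move=> i; rewrite subrr coef1; split; try exact: integers_nat.
exact: (ideal0 idealP).
Qed.

Lemma poly_cong_XsubC a b : O a -> O b -> P (a - b) ->
  poly_cong ('X - a%:P) ('X - b%:P).
Proof.
have OX c i : O c -> O ('X - c%:P)`_i.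
  move=> Oc; rewrite coefB coefX coefC; apply: integersB; first exact: integers_nat.
  by case: eqP => // _; exact: integers0.
move=> Oa Ob Pab i; split; [exact: OX | exact: OX |].
have -> : ('X - a%:P)`_i - ('X - b%:P)`_i = if i == 0%N then - (a - b) else 0.
  by rewrite !coefB !coefC; case: eqP => _; ring.
by case: eqP => _; [exact: (idealN idealP) | exact: (ideal0 idealP)].
Qed.

Lemma poly_cong_prod (I : Type) (r : seq I) (Q : pred I) (F G : I -> {poly L}) :
  (forall i, Q i -> poly_cong (F i) (G i)) ->
  poly_cong (\prod_(i <- r | Q i) F i) (\prod_(i <- r | Q i) G i).
Proof.
move=> FG; apply: (big_ind2 poly_cong) => //; first exact: poly_cong1.
by move=> p p' q q'; exact: poly_congM.
Qed.

End PolyCongruence.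

Lemma XsubC_exp7 (R : comNzRingType) (z : R) :
  ('X - z%:P) ^+ 7 = \poly_(i < 8)
  [:: - z ^+ 7; 7 * z ^+ 6; - 21 * z ^+ 5; 35 * z ^+ 4; - 35 * z ^+ 3;
      21 * z ^+ 2; - 7 * z; 1]`_i.
Proof.
have -> : ('X - z%:P) ^+ 7 = 'X^7 + (- 7 * z)%:P * 'X^6 + (21 * z ^+ 2)%:P * 'X^5
  + (- 35 * z ^+ 3)%:P * 'X^4 + (35 * z ^+ 4)%:P * 'X^3 + (- 21 * z ^+ 5)%:P * 'X^2
  + (7 * z ^+ 6)%:P * 'X + (- z ^+ 7)%:P.
  by rewrite !(polyC_natr, polyC_exp, polyCM, polyCN); ring.
apply/polyP => i; rewrite !(coefD, coefCM, coefXn, coefX, coefC, coef_poly).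
by case: i => [|[|[|[|[|[|[|[|i]]]]]]]]; rewrite /= ?(mulr0, mulr1, add0r, addr0).
Qed.

Section TotallyRamified.

Variables (L : splittingFieldType rat) (t : int) (K E : {subfield L}) (x : L).
Variable P : L -> Prop.
Let O := ring_of_integers E.
Let p : {poly L} := map_poly intr (septic t).
Hypothesis galKE : galois K E.
Hypothesis card7 : #|'Gal(E / K)%g| = 7%N.
Hypothesis defE : <<K; x>>%VS = E.
Hypothesis px : root p x.
Hypothesis prP : nonzero_prime_ideal O P.
Hypothesis totram :
  forall (h : gal_of E) a, h \in 'Gal(E / K)%g -> O a -> P (h a - a).

Let idealP : is_ideal O P. Proof. by case: prP. Qed.

Let Ox : O x.
Proof.
split; first by rewrite -defE memv_adjoin.
exists (septic t); last exact: px.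
by have := monic_map_septic int t; rewrite map_poly_intz.
Qed.

Let sKE : (K <= E)%VS. Proof. by case/and3P: galKE. Qed.

(** Since [x] generates E over K, its seven conjugates are distinct, and a monic polynomial of
    degree 7 is the product over seven distinct roots. *)
Lemma septic_gal_factor : p = \prod_(h in 'Gal(E / K)%g) ('X - (h x)%:P).
Proof.
have Ex : x \in E by case: Ox.

have uniq_hx : uniq [seq (h : gal_of E) x | h <- enum 'Gal(E / K)%g].
  rewrite map_inj_in_uniq ?enum_uniq // => g h; rewrite !mem_enum => gG hG gh.
  apply/eqP/gal_eqP => a Ea.
  have /Fadjoin_polyP[q Kq ->] : a \in <<K; x>>%VS by rewrite defE.
  by rewrite -!horner_map /= !(fixedPoly_gal sKE) // gh.
have ur : uniq_roots [seq (h : gal_of E) x | h <- enum 'Gal(E / K)%g].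
  by rewrite uniq_rootsE.
have := all_roots_prod_XsubC _ _ ur (p := p).
rewrite size_map_septic size_map -cardE card7 big_map big_enum (monicP (monic_map_septic _ _)).
rewrite scale1r; apply=> //.
apply/allP => _ /mapP[h hG ->].
have := rmorph_root h px; rewrite -map_poly_comp.
by congr (root _ _); apply: eq_map_poly => a; exact: (rmorph_int h).
Qed.

(* If all of the Galois group is inertia, the conjugates of [(x - c) w] agree
   modulo [P], so its characteristic polynomial is a seventh power modulo [P]. *)
Lemma totram_coef (c : int) (w : L) :
  let C := p \Po ('X + c%:~R%:P) in w \in K ->
  (forall i, (i < 7)%N -> O (C`_i * w ^+ (7 - i))) ->
  O ((x - c%:~R) * w) /\ forall i, (i < 8)%N ->
    P (C`_i * w ^+ (7 - i) - (('X - ((x - c%:~R) * w)%:P) ^+ 7)`_i).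
Proof.
move=> C Kw OC; pose z := (x - c%:~R) * w.
pose rs := [seq (h : gal_of E) x - c%:~R | h <- enum 'Gal(E / K)%g].
have szrs : size rs = 7%N by rewrite size_map -cardE card7.
have CE : C = \prod_(r <- rs) ('X - r%:P).
  rewrite /C septic_gal_factor rmorph_prod big_map big_enum /=; apply: eq_bigr => h _.
  by rewrite rmorphB /= comp_polyX comp_polyC polyCB; ring.
pose f := \prod_(r <- rs) ('X - (r * w)%:P).
have fE j : (j < 8)%N -> f`_j = C`_j * w ^+ (7 - j).
  by move=> lt_j; rewrite /f coef_prod_XsubC_scale szrs // CE.
have fz : f = \prod_(h in 'Gal(E / K)%g) ('X - (h z)%:P).
  rewrite /f big_map big_enum; apply: eq_bigr => h hG; congr ('X - _%:P).
  by rewrite /z rmorphM rmorphB /= rmorph_int (fixed_gal sKE hG Kw).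
have mon_f : f \is monic by rewrite /f -(big_map (fun r => r * w) xpredT
  (fun r => 'X - r%:P)) monic_prod_XsubC.
have szf : size f = 8%N.
  by rewrite /f -(big_map (fun r => r * w) xpredT (fun r => 'X - r%:P))
    size_prod_XsubC size_map szrs.
have Oz : O z.
  split; first by rewrite /z rpredM ?rpredB ?rpred_int //; [case: Ox | exact: (subvP sKE)].
  (* [w] need not be integral; [z] is, because the coefficients of its characteristic polynomial [f]
     are integral by [OC], the leading one being 1. *)
  apply: (@integral_root_monic _ _ _ _ f).
  - exact: mon_f.
  - rewrite fz /root horner_prod (bigD1 1%g) //= gal_id.
    by rewrite hornerXsubC subrr mul0r.
  apply/integral_poly => j; have [lt_j|le_j] := ltnP j 7.
    rewrite fE; last exact: ltnW. by have [_ h] := OC j lt_j.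
  have [->|ne_j] := eqVneq j 7%N.
    have -> : f`_7 = lead_coef f by rewrite /lead_coef szf.
    by rewrite (monicP mon_f); exact: (integral_nat _ 1).
  rewrite nth_default; first exact: (integral_nat _ 0).
  by rewrite szf ltn_neqAle eq_sym ne_j.
split=> // i lt_i; rewrite -fE // fz.
have -> : ('X - z%:P) ^+ 7 = \prod_(h in 'Gal(E / K)%g) ('X - z%:P).
  by rewrite prodr_const card7.
suff /(_ i)[] : poly_cong E P (\prod_(h in 'Gal(E / K)%g) ('X - (h z)%:P))
    (\prod_(h in 'Gal(E / K)%g) ('X - z%:P)) by [].
apply: (poly_cong_prod idealP) => h hG; apply: (poly_cong_XsubC idealP) => //.
  exact: integers_gal.
exact: totram.
Qed.

Lemma totram_dvd7 : P 7.
Proof.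
have P_div n a : P (7 * a) -> O a -> ~ P n -> n = 7 -> P a.
  move=> P7a Oa nPn n7; rewrite n7 in nPn.
  by case: (prime_idealM prP (integers_nat E 7) Oa P7a).
apply: NNPP => nP7.
have pX : p \Po ('X + 0%:~R%:P) = p by rewrite addr0 comp_polyXr.
have cong (i : nat) : (i < 8)%N -> P (p`_i - (('X - x%:P) ^+ 7)`_i).
  have := @totram_coef 0 1; rewrite /= pX subr0 mulr1 => /(_ (rpred1 _)) h lt_i.
  have [|_] := h; last by move=> /(_ i lt_i); rewrite expr1n mulr1.
  by move=> j _; rewrite expr1n mulr1 /p coef_map; exact: integers_int.
(* The septic has no term of degree 6, whereas the seventh power has -7 x there. *)
have Px : P x.
  have := cong 6 isT; rewrite /p map_septicE XsubC_exp7 !coef_poly /= => h.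
  apply: (P_div 7) => //; have -> : 7 * x = 0 - - 7 * x by ring.
  exact: h.
have Pcoef (i : nat) : (i < 7)%N -> P p`_i.
  move=> lt_i; have := cong i (ltnW lt_i).
  have Pz : P (('X - x%:P) ^+ 7)`_i.
    have PX n : P (x ^+ n.+1) by rewrite exprSr; apply: (ideal_mull idealP) => //; exact: integersX.
    rewrite XsubC_exp7 coef_poly.
    case: i lt_i => [|[|[|[|[|[|[|i]]]]]]] //= _.
    - exact: (idealN idealP).
    - by apply: (ideal_mull idealP) => //; exact: integers_nat.
    - by rewrite mulNr; apply: (idealN idealP); apply: (ideal_mull idealP) => //; exact: integers_nat.
    - by apply: (ideal_mull idealP) => //; exact: integers_nat.
    - by rewrite mulNr; apply: (idealN idealP); apply: (ideal_mull idealP) => //; exact: integers_nat.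
    - by apply: (ideal_mull idealP) => //; exact: integers_nat.
    - by rewrite mulNr; apply: (idealN idealP); apply: (ideal_mull idealP) => //; exact: integers_nat.
  by move=> h; rewrite -[p`_i](subrK (('X - x%:P) ^+ 7)`_i); exact: (idealD idealP).
have := Pcoef 5 isT; have := Pcoef 4 isT; have := Pcoef 3 isT.
rewrite /p map_septicE !coef_poly /= => h3 h4 h5.
have P3 : P 3.
  apply: (P_div 7) => //; last exact: integers_nat.
  by have -> : 7 * 3 = 21 :> L by ring.
have PB : P (t ^+ 2 - 4 * t + 10)%:~R.
  apply: (P_div 7) => //; last exact: integers_int.
  have -> : 7 * (t ^+ 2 - 4 * t + 10)%:~R = - - (7 * (t%:~R ^+ 2 - 4 * t%:~R + 10)) :> L by ring.
  exact: (idealN idealP).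
have PC : P (4 * (t ^+ 2 - 3 * t + 15))%:~R.
  apply: (P_div 7) => //; last exact: integers_int.
  by have -> : 7 * (4 * (t ^+ 2 - 3 * t + 15))%:~R = 28 * (t%:~R ^+ 2 - 3 * t%:~R + 15) :> L by ring.
(* The two quadratics, each times 4, differ by 4 (t + 5), and 3 is in P. At t = -5 the first
   quadratic is 55 = 1 + 18 * 3, which yields 1 in P below. *)
have PT : P (t + 5)%:~R.
  have -> : (t + 5)%:~R = (4 * (t ^+ 2 - 3 * t + 15))%:~R - 4 * (t ^+ 2 - 4 * t + 10)%:~R
    - (t + 5)%:~R * 3 :> L by ring.
  apply: (idealB idealP); last by apply: (ideal_mull idealP) => //; exact: integers_int.
  by apply: (idealB idealP) => //; apply: (ideal_mull idealP) => //; exact: integers_nat.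
apply: (prime_ideal_proper prP).
have -> : 1 = (t ^+ 2 - 4 * t + 10)%:~R - (t - 9)%:~R * (t + 5)%:~R - 18 * 3 :> L by ring.
apply: (idealB idealP); last by apply: (ideal_mull idealP) => //; exact: integers_nat.
by apply: (idealB idealP) => //; apply: (ideal_mull idealP) => //; exact: integers_int.
Qed.

Lemma totram_coef_mem (c : int) (w : L) :
  let C := p \Po ('X + c%:~R%:P) in w \in K ->
  (forall i, (i < 7)%N -> O (C`_i * w ^+ (7 - i))) ->
  forall i, (0 < i < 7)%N -> P (C`_i * w ^+ (7 - i)).
Proof.
move=> C Kw OC i /andP[i_gt0 lt_i].
have [Oz /(_ i (ltnW lt_i)) cong] := totram_coef Kw OC.
have Pm n a : (7 %| n)%N -> O a -> P (n%:R * a).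
  case/dvdnP=> m -> Oa; rewrite natrM mulrAC; apply: (ideal_mull idealP) totram_dvd7.
  by apply: integersM => //; exact: integers_nat.
suff Pe : P ((('X - ((x - c%:~R) * w)%:P) ^+ 7)`_i).
  by rewrite -[X in P X](subrK (('X - ((x - c%:~R) * w)%:P) ^+ 7)`_i); exact: (idealD idealP).
rewrite XsubC_exp7 coef_poly; move: (_ * w) Oz => z Oz.
case: i i_gt0 lt_i {cong} => [|[|[|[|[|[|[|i]]]]]]] //= _ _; rewrite ?mulNr;
  try apply: (idealN idealP); by apply: Pm => //; exact: integersX.
Qed.

End TotallyRamified.

(** * Taylor shifts of the septic and valuations at 7 *)

Lemma poly8E (R : comNzRingType) (a0 a1 a2 a3 a4 a5 a6 a7 : R) :
  \poly_(i < 8) [:: a0; a1; a2; a3; a4; a5; a6; a7]`_i =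
  a7%:P * 'X^7 + a6%:P * 'X^6 + a5%:P * 'X^5 + a4%:P * 'X^4 + a3%:P * 'X^3
  + a2%:P * 'X^2 + a1%:P * 'X + a0%:P.
Proof.
apply/polyP => i; rewrite !(coefD, coefCM, coefXn, coefX, coefC, coef_poly).
by case: i => [|[|[|[|[|[|[|[|i]]]]]]]]; rewrite /= ?(mulr0, mulr1, add0r, addr0).
Qed.

(** Taylor coefficients of the septic at [c], constant term first. The ring is a parameter because
    divisibility is read off over [int] and the polynomial identity holds over the field. *)
Definition septic_shift_coefs (R : comNzRingType) (t c : R) : seq R :=
  let a0 := - t ^+ 5 - 20 * t ^+ 4 - 94 * t ^+ 3 + 410 * t ^+ 2 - 1584 * t + 1224 in
  let a1 := 7 * (5 * t + 6) * (2 * t ^+ 2 - 7 * t + 22) in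
  let a2 := - (7 * (5 * t ^+ 3 - 8 * t ^+ 2 + 12 * t + 72)) in
  let a3 := 28 * (t ^+ 2 - 3 * t + 15) in
  let a4 := - (7 * (t ^+ 2 - 4 * t + 10)) in
  [:: c ^+ 7 + 21 * c ^+ 5 + a4 * c ^+ 4 + a3 * c ^+ 3 + a2 * c ^+ 2 + a1 * c + a0;
      7 * c ^+ 6 + 105 * c ^+ 4 + 4 * a4 * c ^+ 3 + 3 * a3 * c ^+ 2 + 2 * a2 * c + a1;
      21 * c ^+ 5 + 210 * c ^+ 3 + 6 * a4 * c ^+ 2 + 3 * a3 * c + a2;
      35 * c ^+ 4 + 210 * c ^+ 2 + 4 * a4 * c + a3;
      35 * c ^+ 3 + 105 * c + a4;
      21 * c ^+ 2 + 21; 7 * c; 1].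

Lemma septic_shift_identity (R : comNzRingType) (x c a0 a1 a2 a3 a4 : R) :
  (x + c) ^+ 7 + 21 * (x + c) ^+ 5 + a4 * (x + c) ^+ 4 + a3 * (x + c) ^+ 3
    + a2 * (x + c) ^+ 2 + a1 * (x + c) + a0 =
  x ^+ 7 + 7 * c * x ^+ 6 + (21 * c ^+ 2 + 21) * x ^+ 5
    + (35 * c ^+ 3 + 105 * c + a4) * x ^+ 4
    + (35 * c ^+ 4 + 210 * c ^+ 2 + 4 * a4 * c + a3) * x ^+ 3
    + (21 * c ^+ 5 + 210 * c ^+ 3 + 6 * a4 * c ^+ 2 + 3 * a3 * c + a2) * x ^+ 2
    + (7 * c ^+ 6 + 105 * c ^+ 4 + 4 * a4 * c ^+ 3 + 3 * a3 * c ^+ 2 + 2 * a2 * c + a1) * x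
    + (c ^+ 7 + 21 * c ^+ 5 + a4 * c ^+ 4 + a3 * c ^+ 3 + a2 * c ^+ 2 + a1 * c + a0).
Proof. ring. Qed.

Lemma septic_shiftE (R : comNzRingType) (t : int) (c : R) :
  map_poly (intr : int -> R) (septic t) \Po ('X + c%:P) =
  \poly_(i < 8) (septic_shift_coefs t%:~R c)`_i.
Proof.
rewrite map_septicE /septic_shift_coefs.
(* Abstracting the lower coefficients reduces the claim to an identity linear in them, free of
   [t]. *)
move: (- _ ^+ 5 - _ - _ + _ - _ + _) => a0.
move: (7 * (5 * _ + _) * _) => a1.
move: (- (7 * (5 * _ - _ + _ + _))) => a2.
move: (28 * _) => a3.
move: (- (7 * (_ ^+ 2 - _ + _))) => a4.
rewrite !poly8E !(comp_Xn_poly, comp_polyX, comp_polyC, comp_polyD, comp_polyM).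
rewrite !(polyC_natr, polyC_exp, polyC0, polyC1, polyCM, polyCD).
by rewrite !mul1r mul0r addr0; exact: septic_shift_identity.
Qed.

Lemma coef_septic_shift (R : comNzRingType) (t c : int) i : (i < 8)%N ->
  (map_poly (intr : int -> R) (septic t) \Po ('X + c%:~R%:P))`_i =
  ((septic_shift_coefs t c)`_i)%:~R.
Proof.
move=> lt_i; rewrite septic_shiftE coef_poly lt_i /septic_shift_coefs.
by case: i lt_i => [|[|[|[|[|[|[|[|i]]]]]]]] //= _; ring.
Qed.

Lemma integers_root_exp (L : splittingFieldType rat) (E : {subfield L}) (a b : L) n :
  (0 < n)%N -> a \in E -> ring_of_integers E b -> a ^+ n = b -> ring_of_integers E a.
Proof.
move=> n_gt0 Ea [Eb ib] ab; split=> //.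
apply: (@integral_root_monic _ _ _ _ ('X^n - b%:P)).
- exact: monicXnsubC.
- by rewrite /root hornerD hornerN hornerXn hornerC ab subrr.
apply/integral_poly => i; rewrite coefB coefXn coefC; apply: integral_sub.
  exact: integral_nat.
by case: eqP => // _; exact: integral0.
Qed.

Definition unit_mod7 (d : int) : Prop := exists a b, a * d + b * 7 = 1.

Section TotallyRamifiedContradiction.

Variables (L : splittingFieldType rat) (t : int) (K E : {subfield L}) (x y s : L).
Variable P : L -> Prop.
Let O := ring_of_integers E.
Let p : {poly L} := map_poly intr (septic t).
Let delta : int := (t - 2) ^+ 2 + 4.
Hypothesis galKE : galois K E.
Hypothesis card7 : #|'Gal(E / K)%g| = 7%N.
Hypothesis defE : <<K; x>>%VS = E.
Hypothesis px : root p x.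
Hypothesis prP : nonzero_prime_ideal O P.
Hypothesis totram :
  forall (h : gal_of E) a, h \in 'Gal(E / K)%g -> O a -> P (h a - a).
Hypothesis Ks : s \in K.
Hypothesis Ky : y \in K.
Hypothesis ssE : s ^+ 2 = (- 7 * (t - 2) ^+ 2 - 28)%:~R.
Hypothesis y_root : root (map_poly (intr : int -> L) (cubic t)) y.

Let idealP : is_ideal O P. Proof. by case: prP. Qed.
Let P7 : P 7. Proof. exact: totram_dvd7 galKE card7 defE px prP totram. Qed.
Let sKE : (K <= E)%VS. Proof. by case/and3P: galKE. Qed.

Let ssE' : s ^+ 2 = - 7 * delta%:~R.
Proof. by rewrite ssE /delta; ring. Qed.

Let Os : O s.
Proof.
apply: (integers_root_exp (n := 2) _ _ _ ssE) => //; first exact: (subvP sKE).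
exact: integers_int.
Qed.

Let Oy : O y.
Proof.
split; first exact: (subvP sKE).
exists (cubic t); last exact: y_root.
by have := monic_map_cubic int t; rewrite map_poly_intz.
Qed.

Let nz7 : 7 != 0 :> L. Proof. by rewrite (intr_fieldExt_eq0 L 7). Qed.

Lemma totram_unit (d : int) : unit_mod7 d -> ~ P d%:~R.
Proof.
case=> a [b ab] Pd; apply: (prime_ideal_proper prP).
have -> : 1 = a%:~R * d%:~R + b%:~R * 7 :> L.
  by rewrite -[7]/(7%:~R) -!intrM -intrD ab.
by apply: (idealD idealP); apply: (ideal_mull idealP) => //; exact: integers_int.
Qed.

(* [m`_i] is meant to be a power of 7 compensating the denominator of
   [w ^+ (7 - i)]. *)
Lemma totram_contradiction (c : int) (w : L) (m d : seq int) (j : nat) :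
  w \in K ->
  (forall i, (i < 7)%N -> (septic_shift_coefs t c)`_i = m`_i * d`_i) ->
  (forall i, (i < 7)%N -> O ((m`_i)%:~R * w ^+ (7 - i))) ->
  (0 < j < 7)%N -> ~ P ((m`_j)%:~R * w ^+ (7 - j)) ->
  ~ unit_mod7 d`_j.
Proof.
move=> Kw Dm Om lt_j nPm /totram_unit nPd.
have CE i : (i < 7)%N -> (p \Po ('X + c%:~R%:P))`_i * w ^+ (7 - i) =
    (d`_i)%:~R * ((m`_i)%:~R * w ^+ (7 - i)).
  move=> lt_i; rewrite coef_septic_shift; last exact: ltnW. rewrite Dm ?intrM; last exact: lt_i. by ring.
have := totram_coef_mem galKE card7 defE px prP totram (c := c) Kw _ lt_j.
rewrite CE; last by case/andP: lt_j.
move=> h; case: (prime_idealM prP _ _ (h _)) => //.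
- exact: integers_int.
- by apply: Om; case/andP: lt_j.
- by move=> i lt_i; rewrite CE //; apply: integersM; [exact: integers_int | exact: Om].
Qed.

Let P_unit (d : int) : unit_mod7 d -> ~ P d%:~R. Proof. exact: totram_unit. Qed.

Let O_delta : O delta%:~R. Proof. exact: integers_int. Qed.

(** w = s / 7 has valuation -1/2 at 7, so coefficient i must contain 7 to the power (7 - i) / 2
    rounded up. The one used is that of X^5, 21 (c^2 + 1), which times w^2 gives the unit -3 (c^2 +
    1) delta. *)
Lemma totram_contradiction_s (c d0 d1 d2 d3 d4 : int) :
  [/\ (septic_shift_coefs t c)`_0 = 2401 * d0,
      (septic_shift_coefs t c)`_1 = 343 * d1,
      (septic_shift_coefs t c)`_2 = 343 * d2,
      (septic_shift_coefs t c)`_3 = 49 * d3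
    & (septic_shift_coefs t c)`_4 = 49 * d4] ->
  unit_mod7 delta -> ~ unit_mod7 (3 * (c ^+ 2 + 1)).
Proof.
move=> [e0 e1 e2 e3 e4] /P_unit nP_delta.
pose w := s / 7.
have w1 : 7 * w = s by rewrite /w; field; exact: nz7.
have w2 : 7 * w ^+ 2 = - delta%:~R.
  apply: (mulfI nz7); have -> : 7 * (7 * w ^+ 2) = (7 * w) ^+ 2 by ring.
  by rewrite w1 ssE'; ring.
have O2 : O (- delta%:~R) by apply: integersN.
apply: (@totram_contradiction c w [:: 2401; 343; 343; 49; 49; 7; 7]
  [:: d0; d1; d2; d3; d4; 3 * (c ^+ 2 + 1); c] 5) => //.
- by rewrite rpredM ?rpredV // rpred_nat.
- case=> [|[|[|[|[|[|[|i]]]]]]] //= _; rewrite /septic_shift_coefs /=; ring.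
- case=> [|[|[|[|[|[|[|i]]]]]]] //= _.
  + have -> : 2401 * w ^+ 7 = (7 * w ^+ 2) ^+ 3 * (7 * w) by ring.
    by rewrite w1 w2; apply: integersM => //; exact: integersX.
  + have -> : 343 * w ^+ 6 = (7 * w ^+ 2) ^+ 3 by ring.
    by rewrite w2; exact: integersX.
  + have -> : 343 * w ^+ 5 = (7 * w ^+ 2) ^+ 2 * (7 * w) by ring.
    by rewrite w1 w2; apply: integersM => //; exact: integersX.
  + have -> : 49 * w ^+ 4 = (7 * w ^+ 2) ^+ 2 by ring.
    by rewrite w2; exact: integersX.
  + have -> : 49 * w ^+ 3 = (7 * w ^+ 2) * (7 * w) by ring.
    by rewrite w1 w2; exact: integersM.
  + by rewrite w2.
  + by rewrite expr1 w1.
- by rewrite /= w2 => /(idealN idealP); rewrite opprK.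
Qed.

(* [Y = y - b] is a root of an Eisenstein polynomial at [7], so [v ^+ 3 / 7] is
   a unit at [P]. *)
Section ShiftedCubic.

Variables (b al be ga : int).
Hypothesis al_eq : 3 * b - t = 7 * al.
Hypothesis be_eq : 3 * b ^+ 2 - 2 * t * b - (2 * t ^+ 2 - 7 * t + 21) = 7 * be.
Hypothesis ga_eq :
  b ^+ 3 - t * b ^+ 2 - (2 * t ^+ 2 - 7 * t + 21) * b + (t ^+ 3 + 28) = 7 * ga.
Hypothesis unit_ga : unit_mod7 ga.
Hypothesis unit_delta : unit_mod7 delta.

Let v := y - b%:~R.
Let u := - (al%:~R * v ^+ 2 + be%:~R * v + ga%:~R).

Let v3 : v ^+ 3 = 7 * u.
Proof.
have -> : 7 * u = - ((7 * al)%:~R * v ^+ 2 + (7 * be)%:~R * v + (7 * ga)%:~R).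
  by rewrite /u; ring.
rewrite -al_eq -be_eq -ga_eq /v; apply: subr0_eq.
have := root_cubicE y_root => /eqP; rewrite -subr_eq0 => /eqP h.
by rewrite -[RHS]h; ring.
Qed.

Let Ov : O v. Proof. by apply: integersB => //; exact: integers_int. Qed.

Let Ou : O u.
Proof.
apply: integersN; apply: integersD; last exact: integers_int.
by apply: integersD; apply: integersM; rewrite ?expr2; try exact: integers_int;
  try exact: integersM.
Qed.

Let Pv : P v.
Proof.
apply: (prime_idealX prP (n := 3)) => //.
by rewrite v3 mulrC; exact: (ideal_mull idealP).
Qed.

Let nPu : ~ P u.
Proof.
move=> Pu; apply: (P_unit unit_ga).
have -> : ga%:~R = - u - (al%:~R * v + be%:~R) * v by rewrite /u; ring.
apply: (idealB idealP); first exact: (idealN idealP).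
apply: (ideal_mull idealP) => //; apply: integersD; last exact: integers_int.
by apply: integersM => //; exact: integers_int.
Qed.

Let nP_u2delta3 : ~ P (- (u ^+ 2 * delta%:~R ^+ 3)).
Proof.
move/(idealN idealP); rewrite opprK => h.
have [] := prime_idealM prP (integersX 2 Ou) (integersX 3 O_delta) h.
  by move/(prime_idealX prP Ou).
by move/(prime_idealX prP O_delta); exact: P_unit.
Qed.

Let Kv : v \in K. Proof. by rewrite rpredB // rpred_int. Qed.

(** w = v s / 7 has valuation 1/3 + 1/2 - 1 = -1/6. Thus coefficient 0 must contain 49 and the
    others 7; for coefficients 2 to 6 this holds for all [t] and [c]. The test is at degree 1, where
    7 w^6 is a unit. *)
Lemma totram_contradiction_vs (c d0 d1 : int) :
  (septic_shift_coefs t c)`_0 = 49 * d0 ->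
  (septic_shift_coefs t c)`_1 = 7 * d1 -> ~ unit_mod7 d1.
Proof.
move=> e0 e1; pose w := v * s / 7; pose e := v ^+ 2 * s / 7.
have v7 (a : L) : 7 * (a / 7) = a by rewrite mulrC divfK // nz7.
have w1 : 7 * w = v * s by exact: v7.
have w2 : 7 * w ^+ 2 = - (v ^+ 2 * delta%:~R).
  apply: (mulfI nz7); have -> : 7 * (7 * w ^+ 2) = (7 * w) ^+ 2 by ring.
  by rewrite w1 exprMn ssE'; ring.
have w3 : 7 * w ^+ 3 = - (u * delta%:~R * s).
  apply: (mulfI nz7); have -> : 7 * (7 * w ^+ 3) = (7 * w ^+ 2) * (7 * w) by ring.
  have -> : 7 * - (u * delta%:~R * s) = - (7 * u) * delta%:~R * s by ring.
  by rewrite w1 w2 -v3; ring.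
have w4 : 7 * w ^+ 4 = u * v * delta%:~R ^+ 2.
  apply: (mulfI nz7); have -> : 7 * (7 * w ^+ 4) = (7 * w ^+ 2) ^+ 2 by ring.
  have -> : 7 * (u * v * delta%:~R ^+ 2) = (7 * u) * v * delta%:~R ^+ 2 by ring.
  by rewrite w2 -v3; ring.
have w5 : 7 * w ^+ 5 = u * delta%:~R ^+ 2 * e.
  apply: (mulfI nz7); have -> : 7 * (7 * w ^+ 5) = (7 * w ^+ 4) * (7 * w) by ring.
  have -> : 7 * (u * delta%:~R ^+ 2 * e) = u * delta%:~R ^+ 2 * (7 * e) by ring.
  by rewrite w4 w1 v7; ring.
have w6 : 7 * w ^+ 6 = - (u ^+ 2 * delta%:~R ^+ 3).
  apply: (mulfI nz7); have -> : 7 * (7 * w ^+ 6) = (7 * w ^+ 3) ^+ 2 by ring.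
  have -> : (7 * w ^+ 3) ^+ 2 = u ^+ 2 * delta%:~R ^+ 2 * s ^+ 2 by rewrite w3; ring.
  by rewrite ssE'; ring.
have w7 : 49 * w ^+ 7 = - (u ^+ 2 * delta%:~R ^+ 3) * (v * s).
  by rewrite -w6 -w1; ring.
(* [e] has valuation 2/3 + 1/2 - 1 = 1/6, the valuation of 7 w^5; its integrality is visible only on
   its cube. *)
have Oe : O e.
  apply: (integers_root_exp (n := 3) (b := - (u ^+ 2 * delta%:~R * s))) => //.
  - by apply: (subvP sKE); rewrite !(rpredM, rpredX, rpredV) // rpred_nat.
  - by apply: integersN; do 2!apply: integersM => //; exact: integersX.
  apply: (mulfI nz7); apply: (mulfI nz7); apply: (mulfI nz7).
  have -> : 7 * (7 * (7 * e ^+ 3)) = (7 * e) ^+ 3 by ring.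
  have -> : (7 * e) ^+ 3 = (v ^+ 3) ^+ 2 * s ^+ 2 * s by rewrite v7; ring.
  by rewrite v3 ssE'; ring.
apply: (@totram_contradiction c w [:: 49; 7; 7; 7; 7; 7; 7]
  [:: d0; d1; 3 * c ^+ 5 + 30 * c ^+ 3 - 6 * (t ^+ 2 - 4 * t + 10) * c ^+ 2
        + 12 * (t ^+ 2 - 3 * t + 15) * c - (5 * t ^+ 3 - 8 * t ^+ 2 + 12 * t + 72);
      5 * c ^+ 4 + 30 * c ^+ 2 - 4 * (t ^+ 2 - 4 * t + 10) * c + 4 * (t ^+ 2 - 3 * t + 15);
      5 * c ^+ 3 + 15 * c - (t ^+ 2 - 4 * t + 10); 3 * (c ^+ 2 + 1); c] 1) => //.
- by rewrite !(rpredM, rpredV) // rpred_nat.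
- case=> [|[|[|[|[|[|[|i]]]]]]] //= _; rewrite /septic_shift_coefs /=; ring.
- case=> [|[|[|[|[|[|[|i]]]]]]] //= _.
  + rewrite w7; apply: integersM; last exact: integersM.
    by apply: integersN; apply: integersM; exact: integersX.
  + by rewrite w6; apply: integersN; apply: integersM; exact: integersX.
  + by rewrite w5; apply: integersM => //; apply: integersM => //; exact: integersX.
  + by rewrite w4; apply: integersM; [exact: integersM | exact: integersX].
  + by rewrite w3; apply: integersN; apply: integersM => //; exact: integersM.
  + by rewrite w2; apply: integersN; apply: integersM => //; exact: integersX.
  + by rewrite expr1 w1; exact: integersM.
- by rewrite /= w6.
Qed.

(** This w is the square of v s / 7 and has valuation -1/3, so coefficient i must contain 7 to the
    power (7 - i) / 3 rounded up. The test is at degree 4, where 7 w^3 is a unit. *)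
Lemma totram_contradiction_v2 (c d0 d1 d2 d3 d4 : int) :
  [/\ (septic_shift_coefs t c)`_0 = 343 * d0,
      (septic_shift_coefs t c)`_1 = 49 * d1,
      (septic_shift_coefs t c)`_2 = 49 * d2,
      (septic_shift_coefs t c)`_3 = 49 * d3
    & (septic_shift_coefs t c)`_4 = 7 * d4] -> ~ unit_mod7 d4.
Proof.
move=> [e0 e1 e2 e3 e4]; pose w := - (v ^+ 2 * delta%:~R) / 7.
have w1 : 7 * w = - (v ^+ 2 * delta%:~R) by rewrite mulrC divfK // nz7.
have w2 : 7 * w ^+ 2 = u * v * delta%:~R ^+ 2.
  apply: (mulfI nz7); have -> : 7 * (7 * w ^+ 2) = (7 * w) ^+ 2 by ring.
  have -> : 7 * (u * v * delta%:~R ^+ 2) = (7 * u) * v * delta%:~R ^+ 2 by ring.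
  by rewrite w1 -v3; ring.
have w3 : 7 * w ^+ 3 = - (u ^+ 2 * delta%:~R ^+ 3).
  apply: (mulfI nz7); have -> : 7 * (7 * w ^+ 3) = (7 * w ^+ 2) * (7 * w) by ring.
  have -> : 7 * - (u ^+ 2 * delta%:~R ^+ 3) = - ((7 * u) * u * delta%:~R ^+ 3) by ring.
  by rewrite w1 w2 -v3; ring.
have O3 : O (- (u ^+ 2 * delta%:~R ^+ 3)).
  by apply: integersN; apply: integersM; exact: integersX.
have O2 : O (u * v * delta%:~R ^+ 2).
  by apply: integersM; [exact: integersM | exact: integersX].
have O1 : O (- (v ^+ 2 * delta%:~R)).
  by apply: integersN; apply: integersM => //; exact: integersX.
apply: (@totram_contradiction c w [:: 343; 49; 49; 49; 7; 7; 7]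
  [:: d0; d1; d2; d3; d4; 3 * (c ^+ 2 + 1); c] 4) => //.
- by rewrite !(rpredM, rpredN, rpredX, rpredV, rpred_int) // rpred_nat.
- case=> [|[|[|[|[|[|[|i]]]]]]] //= _; rewrite /septic_shift_coefs /=; ring.
- case=> [|[|[|[|[|[|[|i]]]]]]] //= _.
  + have -> : 343 * w ^+ 7 = (7 * w ^+ 3) ^+ 2 * (7 * w) by ring.
    by rewrite w3 w1; apply: integersM => //; exact: integersX.
  + have -> : 49 * w ^+ 6 = (7 * w ^+ 3) ^+ 2 by ring.
    by rewrite w3; exact: integersX.
  + have -> : 49 * w ^+ 5 = (7 * w ^+ 3) * (7 * w ^+ 2) by ring.
    by rewrite w3 w2; exact: integersM.
  + have -> : 49 * w ^+ 4 = (7 * w ^+ 3) * (7 * w) by ring.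
    by rewrite w3 w1; exact: integersM.
  + by rewrite w3.
  + by rewrite w2.
  + by rewrite expr1 w1.
- by rewrite /= w3.
Qed.

End ShiftedCubic.

End TotallyRamifiedContradiction.

(** * The residue classes of t *)

Lemma eqz_mod_ex (m t a : int) : (t = a %[mod m])%Z -> exists k, t = a + m * k.
Proof.
move/eqP; rewrite eqz_mod_dvd => /dvdzP[k h]; exists k.
by rewrite mulrC -h addrC subrK.
Qed.

Lemma congruence_not_totram (L : splittingFieldType rat) (t : int)
  (K E : {subfield L}) (x y s : L) (P : L -> Prop) (O := ring_of_integers E) :
  congruence_condition t ->
  galois K E -> #|'Gal(E / K)%g| = 7%N -> <<K; x>>%VS = E ->
  root (map_poly (intr : int -> L) (septic t)) x ->
  nonzero_prime_ideal O P ->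
  (forall (h : gal_of E) a, h \in 'Gal(E / K)%g -> O a -> P (h a - a)) ->
  s \in K -> y \in K -> s ^+ 2 = (- 7 * (t - 2) ^+ 2 - 28)%:~R ->
  root (map_poly (intr : int -> L) (cubic t)) y -> False.
(* The shifts [c], [b] were found by search in each residue class; the remaining
   arguments are the resulting quotients, expanded in [k]. *)
Proof.
move=> ht galKE card7 defE px prP totram Ks Ky ssE y_root.
(* The search is narrow: modulo 7 the cubic is (Y - 5 t)^3, so b is 5 t modulo 7, and the septic is
   X^7 plus its constant term, so c is minus that term modulo 7. In the classes modulo 49 the
   requirement that [unit_ga] expresses makes the shifted cubic Eisenstein. *)
case: ht => [h|[h|[h|[h|[h|[h|h]]]]]].
- have [k tE] := eqz_mod_ex h.
  apply: (totram_contradiction_s galKE card7 defE px prP totram Ks ssE (c := 1)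
    (d0 := ((((((- 7) * k + (- 30)) * k + (- 37)) * k + (- 12)) * k + (- 4)) * k))
    (d1 := ((1 * k + 4) * k + 4))
    (d2 := ((((- 35) * k + (- 16)) * k + (- 4)) * k + 1))
    (d3 := (4 * k + 9)) (d4 := (((- 7) * k) * k + 2))).
  + by rewrite /septic_shift_coefs /= tE; split; ring.
  + by exists 2, (((- 14) * k) * k + (- 1)); rewrite ?tE; ring.
  + by exists 6, (- 5); rewrite ?tE; ring.
- have [k tE] := eqz_mod_ex h.
  apply: (totram_contradiction_vs galKE card7 defE px prP totram Ks Ky ssE y_root
    (b := 0) (al := ((- 7) * k + 3)) (be := (((- 686) * k + 637) * k + (- 150)))
    (ga := ((((16 * 1000 + 807) * k + (- (21 * 1000 + 609))) * k + (9 * 1000 + 261)) * k + (- (1 * 1000 + 319)))) _ _ _ _ _ (c := 1)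
    (d0 := ((((((- ((5 * 1000 + 764) * 1000 + 801)) * k + ((10 * 1000) * 1000 + 165)) * k + (- ((6 * 1000 + 696) * 1000 + 389))) * k + ((2 * 1000 + 142) * 1000 + 917)) * k + (- (324 * 1000 + 522))) * k + (18 * 1000 + 630)))
    (d1 := (((2 * 1000 + 401) * k + (- 882)) * k + 81))).
  + by rewrite tE; ring.
  + by rewrite tE; ring.
  + by rewrite tE; ring.
  + by exists 2, ((((- (4 * 1000 + 802)) * k + (6 * 1000 + 174)) * k + (- (2 * 1000 + 646))) * k + 377); rewrite ?tE; ring.
  + by exists 1, (((- 343) * k + 322) * k + (- 76)); rewrite ?tE; ring.
  + by rewrite /septic_shift_coefs /= tE; ring.
  + by rewrite /septic_shift_coefs /= tE; ring.
  + by exists 2, (((- 686) * k + 252) * k + (- 23)); rewrite ?tE; ring.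
- have [k tE] := eqz_mod_ex h.
  apply: (totram_contradiction_vs galKE card7 defE px prP totram Ks Ky ssE y_root
    (b := 1) (al := ((- 7) * k + 3)) (be := (((- 686) * k + 539) * k + (- 108)))
    (ga := ((((16 * 1000 + 807) * k + (- (19 * 1000 + 208))) * k + (7 * 1000 + 350)) * k + (- 940))) _ _ _ _ _ (c := 4)
    (d0 := ((((((- ((5 * 1000 + 764) * 1000 + 801)) * k + ((8 * 1000 + 235) * 1000 + 430)) * k + (- ((5 * 1000 + 219) * 1000 + 774))) * k + ((1 * 1000 + 974) * 1000 + 602)) * k + (- (444 * 1000 + 912))) * k + (45 * 1000 + 216)))
    (d1 := ((((- ((3 * 1000 + 529) * 1000 + 470)) * k + ((3 * 1000 + 834) * 1000 + 397)) * k + (- ((1 * 1000 + 367) * 1000 + 688))) * k + (167 * 1000 + 760)))).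
  + by rewrite tE; ring.
  + by rewrite tE; ring.
  + by rewrite tE; ring.
  + by exists 3, ((((- (7 * 1000 + 203)) * k + (8 * 1000 + 232)) * k + (- (3 * 1000 + 150))) * k + 403); rewrite ?tE; ring.
  + by exists 3, (((- (1 * 1000 + 29)) * k + 840) * k + (- 173)); rewrite ?tE; ring.
  + by rewrite /septic_shift_coefs /= tE; ring.
  + by rewrite /septic_shift_coefs /= tE; ring.
  + by exists 3, (((((1 * 1000 + 512) * 1000 + 630) * k + (- ((1 * 1000 + 643) * 1000 + 313))) * k + (586 * 1000 + 152)) * k + (- (71 * 1000 + 897))); rewrite ?tE; ring.
- have [k tE] := eqz_mod_ex h.
  apply: (totram_contradiction_vs galKE card7 defE px prP totram Ks Ky ssE y_root
    (b := 4) (al := ((- 7) * k + 4)) (be := (((- 686) * k + 441) * k + (- 67)))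
    (ga := ((((16 * 1000 + 807) * k + (- (19 * 1000 + 208))) * k + (7 * 1000 + 252)) * k + (- 904))) _ _ _ _ _ (c := 0)
    (d0 := ((((((- ((5 * 1000 + 764) * 1000 + 801)) * k + ((7 * 1000 + 58) * 1000 + 940)) * k + (- ((3 * 1000 + 298) * 1000 + 974))) * k + (742 * 1000 + 938)) * k + (- (86 * 1000 + 896))) * k + (5 * 1000 + 192)))
    (d1 := (((((1 * 1000 + 176) * 1000 + 490) * k + (- ((1 * 1000 + 207) * 1000 + 703))) * k + (415 * 1000 + 716)) * k + (- (47 * 1000 + 804))))).
  + by rewrite tE; ring.
  + by rewrite tE; ring.
  + by rewrite tE; ring.
  + by exists 6, ((((- (14 * 1000 + 406)) * k + (16 * 1000 + 464)) * k + (- (6 * 1000 + 216))) * k + 775); rewrite ?tE; ring.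
  + by exists 6, (((- (2 * 1000 + 58)) * k + (1 * 1000 + 512)) * k + (- 281)); rewrite ?tE; ring.
  + by rewrite /septic_shift_coefs /= tE; ring.
  + by rewrite /septic_shift_coefs /= tE; ring.
  + by exists 6, ((((- ((1 * 1000 + 8) * 1000 + 420)) * k + ((1 * 1000 + 35) * 1000 + 174)) * k + (- (356 * 1000 + 328))) * k + (40 * 1000 + 975)); rewrite ?tE; ring.
- have [k tE] := eqz_mod_ex h.
  (* Here coefficient 1 of the shifted septic is divisible by 49, so the test at degree 1 cannot
     succeed and the one at degree 4 takes over. *)
  apply: (totram_contradiction_v2 galKE card7 defE px prP totram Ky y_root
    (b := 2) (al := ((- 7) * k + 2)) (be := (((- 686) * k + 245) * k + (- 23)))
    (ga := ((((16 * 1000 + 807) * k + (- (9 * 1000 + 604))) * k + (1 * 1000 + 862)) * k + (- 122))) _ _ _ _ _ (c := 39)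
    (d0 := ((((((- (823 * 1000 + 543)) * k + (336 * 1000 + 140)) * k + (- ((17 * 1000 + 355) * 1000 + 457))) * k + (- ((92 * 1000 + 694) * 1000 + 224))) * k + ((40 * 1000 + 178) * 1000 + 544)) * k + ((401 * 1000 + 199) * 1000 + 148)))
    (d1 := ((((- ((6 * 1000 + 386) * 1000 + 660)) * k + (- ((71 * 1000 + 790) * 1000 + 929))) * k + ((30 * 1000 + 207) * 1000 + 16)) * k + ((504 * 1000 + 344) * 1000 + 80)))
    (d2 := ((((- (84 * 1000 + 35)) * k + (- ((2 * 1000 + 925) * 1000 + 790))) * k + ((1 * 1000 + 207) * 1000 + 696)) * k + ((38 * 1000 + 790) * 1000 + 873)))
    (d3 := (((- (52 * 1000 + 136)) * k + (21 * 1000 + 308)) * k + ((1 * 1000 + 656) * 1000 + 673)))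
    (d4 := (((- (2 * 1000 + 401)) * k + 980) * k + (297 * 1000 + 74)))).
  + by rewrite tE; ring.
  + by rewrite tE; ring.
  + by rewrite tE; ring.
  + by exists 2, ((((- (4 * 1000 + 802)) * k + (2 * 1000 + 744)) * k + (- 532)) * k + 35); rewrite ?tE; ring.
  + by exists 6, (((- (2 * 1000 + 58)) * k + 840) * k + (- 89)); rewrite ?tE; ring.
  + by rewrite /septic_shift_coefs /= tE; split; ring.
  + by exists 1, ((343 * k + (- 140)) * k + (- (42 * 1000 + 439))); rewrite ?tE; ring.
- have [k tE] := eqz_mod_ex h.
  apply: (totram_contradiction_vs galKE card7 defE px prP totram Ks Ky ssE y_root
    (b := 6) (al := ((- 7) * k + 1)) (be := (((- 686) * k + (- 343)) * k + (- 30)))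
    (ga := ((((16 * 1000 + 807) * k + (7 * 1000 + 203)) * k + 735) * k + 9)) _ _ _ _ _ (c := 2)
    (d0 := ((((((- ((5 * 1000 + 764) * 1000 + 801)) * k + (- ((8 * 1000 + 823) * 1000 + 675))) * k + (- ((5 * 1000 + 243) * 1000 + 784))) * k + (- ((1 * 1000 + 494) * 1000 + 892))) * k + (- (205 * 1000 + 671))) * k + (- (10 * 1000 + 953))))
    (d1 := ((((- ((1 * 1000 + 176) * 1000 + 490)) * k + (- (732 * 1000 + 305))) * k + (- (150 * 1000 + 724))) * k + (- (9 * 1000 + 693))))).
  + by rewrite tE; ring.
  + by rewrite tE; ring.
  + by rewrite tE; ring.
  + by exists 4, ((((- (9 * 1000 + 604)) * k + (- (4 * 1000 + 116))) * k + (- 420)) * k + (- 5)); rewrite ?tE; ring.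
  + by exists 1, (((- 343) * k + (- 126)) * k + (- 12)); rewrite ?tE; ring.
  + by rewrite /septic_shift_coefs /= tE; ring.
  + by rewrite /septic_shift_coefs /= tE; ring.
  + by exists 4, ((((672 * 1000 + 280) * k + (418 * 1000 + 460)) * k + (86 * 1000 + 128)) * k + (5 * 1000 + 539)); rewrite ?tE; ring.
- have [k tE] := eqz_mod_ex h.
  (* The valuation -1/2 asks for 7^4 in the value of the septic at c, whence the modulus 2401. For t
     = 2 modulo 7 the same divisibility with c = 1 holds on the whole class. *)
  apply: (totram_contradiction_s galKE card7 defE px prP totram Ks ssE (c := 37)
    (d0 := ((((((- ((((33 * 1000 + 232) * 1000 + 930) * 1000 + 569) * 1000 + 601)) * k + (- ((((51 * 1000 + 697) * 1000 + 207) * 1000 + 695) * 1000 + 735))) * k + (- ((((32 * 1000 + 429) * 1000 + 17) * 1000 + 540) * 1000 + 549))) * k + (- ((((10 * 1000 + 278) * 1000 + 293) * 1000 + 543) * 1000 + 427))) * k + (- ((((1 * 1000 + 649) * 1000 + 58) * 1000 + 475) * 1000 + 306))) * k + (- (((107 * 1000 + 225) * 1000 + 404) * 1000 + 230))))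
    (d1 := ((((- (((101 * 1000 + 691) * 1000 + 89) * 1000 + 640)) * k + (- (((116 * 1000 + 243) * 1000 + 682) * 1000 + 695))) * k + (- (((42 * 1000 + 692) * 1000 + 546) * 1000 + 834))) * k + (- (((5 * 1000 + 40) * 1000 + 278) * 1000 + 615))))
    (d2 := ((((- (((1 * 1000 + 412) * 1000 + 376) * 1000 + 245)) * k + (- (((2 * 1000 + 224) * 1000 + 389) * 1000 + 643))) * k + (- ((969 * 1000 + 394) * 1000 + 195))) * k + (- ((124 * 1000 + 550) * 1000 + 552))))
    (d3 := (((- ((118 * 1000 + 590) * 1000 + 192)) * k + (- ((73 * 1000 + 197) * 1000 + 572))) * k + (- ((9 * 1000 + 950) * 1000 + 523)))) (d4 := (((- (823 * 1000 + 543)) * k + (- (508 * 1000 + 326))) * k + (- (42 * 1000 + 181))))).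
  + by rewrite /septic_shift_coefs /= tE; split; ring.
  + by exists 3, (((- ((2 * 1000 + 470) * 1000 + 629)) * k + (- ((1 * 1000 + 524) * 1000 + 978))) * k + (- (235 * 1000 + 322))); rewrite ?tE; ring.
  + by exists 1, (- 587); rewrite ?tE; ring.
Qed.

(** * Infinite places and conclusion *)

Lemma unramified_infinite_of_negative_square (L : splittingFieldType rat)
  (K E : {subfield L}) (s : L) (n : int) :
  (K <= E)%VS -> s \in K -> s ^+ 2 = n%:~R -> n < 0 -> unramified_infinite K E.
Proof.
move=> sKE Ks ssE n_lt0 f realK; have Es : s \in E := subvP sKE _ Ks.
have /real_exprn_even_ge0 : f (Subvs Es) \is Num.real by exact: realK.
move=> /(_ 2%N isT); rewrite -rmorphXn.
have -> : Subvs Es ^+ 2 = n%:~R.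
  apply: (fmorph_inj (vsval : {rmorphism subvs_of E -> L})).
  by rewrite rmorphXn rmorph_int.
by rewrite rmorph_int ler0z leNgt n_lt0.
Qed.

Theorem theorem11 (t : int) (ht : congruence_condition t)
    (hcubic : irreducible_poly (map_poly (intr : int -> rat) (cubic t))) :
  (forall (L : splittingFieldType rat) (y : L),
      root (map_poly (intr : int -> L) (cubic t)) y ->
      cyclic_extension 1%AS <<1; y>>%AS) /\
  (irreducible_poly (map_poly (intr : int -> rat) (septic t)) ->
   forall (L : splittingFieldType rat) (y s : L) (E : {subfield L}),
      root (map_poly (intr : int -> L) (cubic t)) y ->
      s ^+ 2 = (- 7 * (t - 2) ^+ 2 - 28)%:~R ->
      let K : {subfield L} := <<<<1; s>>; y>>%AS in
      splittingFieldFor K (map_poly (intr : int -> L) (septic t)) E ->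
      cyclic_extension K E /\ unramified_extension K E).
Proof.
split=> [L y|irr_septic L y s E y_root ssE K splitE]; first exact: cubic_cyclic.
have [x px] : exists x, root (map_poly (intr : int -> L) (septic t)) x.
  have [rs p_rs _] := splitE; case: rs p_rs => [|x rs] p_rs.
    by have := eqp_size p_rs; rewrite big_nil size_map_septic size_poly1.
  by exists x; rewrite (eqp_root p_rs) root_prod_XsubC mem_head.
have [cyc defE] := septic_cyclic hcubic irr_septic y_root ssE splitE px.
have [galKE _] := cyc; have sKE : (K <= E)%VS by case/and3P: galKE.
have card7 : #|'Gal(E / K)%g| = 7%N.
  rewrite -galois_dim // -defE -adjoin_degreeE.
  exact: (adjoin_degree_septic irr_septic y_root ssE px).
have Ks : s \in K by apply: subvP_adjoin; exact: memv_adjoin.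
have Ky : y \in K by exact: memv_adjoin.
split=> //; split=> // [P prP|].
  (* If P failed to have index 1, then by [ramification_index1] no automorphism could move an
     integer modulo P, which the congruence on [t] excludes. *)
  apply: NNPP => ram.
  apply: (congruence_not_totram ht galKE card7 defE px prP _ Ks Ky ssE y_root).
  move=> h a hG Oa; apply: NNPP => nPa; apply: ram.
  by apply: (ramification_index1 galKE prP _ hG Oa nPa); rewrite card7.
apply: (unramified_infinite_of_negative_square sKE Ks ssE).
by have := sqr_ge0 (t - 2); lia.
Qed.
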